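(* For every $\varepsilon>0$ and every sequence $\ell=\ell(n)$ of positive integers with $\ell\le (1-\varepsilon)n$ for all sufficiently large $n$, almost all $\ell$-lifts of $K_n$ do not contain a topological clique of order $n$; that is, if $G$ is a uniformly random $\ell$-lift of $K_n$, then the probability that $G$ contains a topological clique of order $n$ as a subgraph tends to $0$ as $n\to\infty$.
   Context: An $\ell$-lift of a graph $H$ is a graph obtained by replacing every vertex $v$ of $H$ by an independent set (the fiber of $v$) of $\ell$ vertices, say $\{v\}\times\{1,\dots,\ell\}$, and placing, for each edge $uv$ of $H$, a perfect matching (of size $\ell$) between the fibers of $u$ and $v$; there are no other edges. A uniformly random $\ell$-lift of $H$ is obtained by choosing, independently for each edge $uv$ of $H$, a uniformly random perfect matching between the fibers of $u$ and $v$. Almost all $\ell$-lifts of $K_n$ satisfy a property if the proportion of $\ell$-lifts of $K_n$ failing it tends to $0$ as $n\to\infty$. A topological clique of order $m$ (equivalently, a subdivision of $K_m$) is a graph consisting of $m$ branch vertices, all pairs of which are joined by pairwise internally vertex-disjoint paths (one path for each pair, whose internal vertices are not branch vertices). The condition ''$\ell\le(1-o(1))n$'' is expressed as: for every fixed $\varepsilon>0$, the conclusion holds whenever $\ell\le(1-\varepsilon)n$.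
   Formalization: The formal theorem additionally assumes ℓ(n) ≥ 2 for all sufficiently large n; if ℓ(n) = 1 the only lift of K_n is K_n itself, which is a topological clique of order n, so the claim fails exactly for sequences with ℓ(n) = 1 infinitely often. *)

(* Defs.v *)
(* MathComp and MathComp-Analysis *)
From mathcomp Require Import all_boot all_order all_algebra.
From mathcomp Require Import boolp classical_sets reals topology normedtype.
From mathcomp Require Import sequences.

Set Implicit Arguments.
Unset Strict Implicit.
Unset Printing Implicit Defensive.

Import Order.TTheory GRing.Theory Num.Theory.
Import numFieldNormedType.Exports.

Local Open Scope ring_scope.

(* A simple graph on the vertex type T is given by its set of edges, each edge
   being a set of two vertices; hence distinct edge sets are distinct graphs. *)
Definition simple_graph (T : finType) (G : {set {set T}}) : bool :=
  [forall e in G, #|e| == 2%N].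

Definition adj (T : finType) (G : {set {set T}}) : rel T :=
  fun x y => (x != y) && ([set x; y] \in G).

Definition complete_graph (T : finType) : {set {set T}} :=
  [set e : {set T} | #|e| == 2%N].

Definition fiber (V : finType) (l : nat) (v : V) : {set V * 'I_l} :=
  [set x | x.1 == v].

(* The edges of G between the disjoint vertex sets A and B form a perfect
   matching of A and B. *)
Definition perfect_matching (T : finType) (G : {set {set T}}) (A B : {set T})
    : bool :=
  [forall x in A, #|[set y in B | adj G x y]| == 1%N] &&
  [forall y in B, #|[set x in A | adj G x y]| == 1%N].

(* The second conjunct says that every edge of G lies over an edge of H; in
   particular the fibers are independent sets. *)
Definition is_lift (V : finType) (H : {set {set V}}) (l : nat)
    (G : {set {set V * 'I_l}}) : bool :=
  [&& simple_graph G,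
      [forall x, forall y, adj G x y ==> adj H x.1 y.1] &
      [forall u, forall v,
         adj H u v ==> perfect_matching G (fiber l u) (fiber l v)]].

Definition lifts (V : finType) (H : {set {set V}}) (l : nat)
    : {set {set {set V * 'I_l}}} :=
  [set G | is_lift H G].

(* G contains a topological clique of order m: b lists the branch vertices, and
   for i < j the sequence p i j lists, in order, the internal vertices of the
   path joining b i to b j.  The values p i j with j <= i are irrelevant. *)
Definition has_topological_clique (T : finType) (m : nat) (G : {set {set T}})
    : Prop :=
  exists (b : 'I_m -> T) (p : 'I_m -> 'I_m -> seq T),
    [/\ injective b,
        forall i j : 'I_m, (i < j)%N ->
          path (adj G) (b i) (rcons (p i j) (b j)) /\
          uniq (b i :: rcons (p i j) (b j)),
        forall i j k : 'I_m, (i < j)%N -> b k \notin p i j &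
        forall i j i' j' : 'I_m, (i < j)%N -> (i' < j')%N ->
          (i, j) <> (i', j') -> ~~ has (mem (p i j)) (p i' j')].

(* The probability that a uniformly random l-lift of H satisfies P.  Choosing
   the perfect matchings over the edges of H independently and uniformly yields
   every l-lift of H with the same probability, so this is the proportion of
   the l-lifts of H that satisfy P. *)
Definition lift_probability (R : realType) (V : finType) (H : {set {set V}})
    (l : nat) (P : {set {set V * 'I_l}} -> Prop) : R :=
  #|[set G in lifts H l | `[< P G >]]|%:R / #|lifts H l|%:R.
Arguments lift_probability R {V} H l P.

(* Main.v *)
Require Import Defs.
From mathcomp Require Import all_boot all_order all_algebra all_fingroup.
From mathcomp Require Import boolp classical_sets reals topology normedtype.
From mathcomp Require Import sequences exp.
From mathcomp Require Import zify ring lra.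

Set Implicit Arguments.
Unset Strict Implicit.
Unset Printing Implicit Defensive.

Import Order.TTheory GRing.Theory Num.Theory.
Import numFieldNormedType.Exports.

Local Open Scope nat_scope.

(** Every vertex of a lift of K_n has degree n - 1, so a topological clique of
order n uses every edge at each of its branch vertices.  Let B be the set of
branch vertices.  A vertex w outside B that is adjacent to two branch vertices
is then an inner vertex of the path joining them and the neighbour of both on
that path.  Hence w has at most two neighbours in B, and two branch vertices
have at most one common neighbour outside B ([branch_like] and
[clique_branch_like]).  There are at most n^(2n) candidates for B, so it
suffices that a fixed n-set B has these two properties with probability
exp(-c n^2), up to factors n^(O(n)).

All probability estimates go through relabellings: composing the perfect
matchings of a lift with permutations of the fibers permutes the set of lifts,
so it is enough to bound, for each single lift, the proportion of relabellings
that lead to a bad lift ([twist_average]).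

Let e be the number of edges inside B.  Counting the edges that leave B with
the first property gives n(n-1) <= 2e + 2(nl - n) ([inner_edges_lower]), while m
prescribed edges are all present with probability at most l^(-m/2)
([card_upward_edges], [inner_edges_prob]).  If l is bounded, all but O(n) of
the pairs in B have to be edges ([dense_prob_small]); if l is large, even a
small constant proportion of the n^2 pairs is too unlikely
([dense_prob_large]).

There remains the case that e is at most a small multiple of n^2, and then l is
at least n/4.  A fiber has at most l <= (1 - eps) n vertices, so the set of
fibers can be split in two in such a way that both sides contain linearly many
vertices of B ([branch_split]).  Let X be the part of B on one side, and let
the probes be K vertices of B on the other side, K being a small multiple of n.
Only the matchings at the fibers of the probes are relabelled.  Up to a factor
exp(O(K^2)), the neighbours of the probes in the other fibers are then
independent uniform choices ([card_landing]).  By the second property, the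
neighbours outside B of one probe lying in different fibers have no common
neighbour in X.  This is a birthday problem: within the first half of the
fibers the probe reaches a positive proportion of X, and in the second half it
has to avoid reaching any of these vertices again, which has probability
exp(-c n) ([card_collision_free]).  Over the K probes this gives exp(-c n K),
that is, exp(-c' n^2) ([sparse_prob]). *)

(** * Finite sets *)

Lemma sum_card_pairs (I T : finType) (P : pred I) (F : I -> {set T}) :
  \sum_(i | P i) #|F i| =
  #|[set it : I * T | P it.1 && (it.2 \in F it.1)]%SET|.
Proof.
under eq_bigr do rewrite -sum1_card.
rewrite pair_big_dep -[RHS]sum1_card; apply: eq_bigl => -[i t].
by rewrite finset.inE.
Qed.

Lemma card_bigcup_le (I T : finType) (P : pred I) (F : I -> {set T}) :
  #|\bigcup_(i | P i) F i| <= \sum_(i | P i) #|F i|.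
Proof.
elim/big_rec2: _ => [|i m A _ h]; first by rewrite finset.cards0.
by apply: (leq_trans (leq_card_setU _ _)); rewrite leq_add2l.
Qed.

Lemma subset_of_card (T : finType) (A : {set T}) k : k <= #|A| ->
  exists2 C : {set T}, C \subset A & #|C| = k.
Proof.
case/card_geqP => s [us sk sA]; exists [set x in s]%SET.
  by apply/fintype.subsetP => x; rewrite finset.inE => /sA.
by rewrite cardsE (card_uniqP us).
Qed.

Lemma union_bound (R : realType) (T I : finType) (S : {set T}) (J : {set I})
    (Q : pred T) (F : I -> pred T) (c : R) :
  (forall x, x \in S -> Q x -> exists2 i, i \in J & F i x) ->
  (forall i, i \in J -> (#|[set x in S | F i x]%SET|%:R <= c)%R) ->
  (#|[set x in S | Q x]%SET|%:R <= #|J|%:R * c)%R.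
Proof.
move=> SQ Fc.
apply: (@le_trans _ _ (\sum_(i in J) #|[set x in S | F i x]%SET|)%:R%R).
  rewrite ler_nat.
  apply: (@leq_trans #|\bigcup_(i in J) [set x in S | F i x]%SET|).
    apply: subset_leq_card; apply/fintype.subsetP => x; rewrite finset.inE.
    case/andP => xS /(SQ x xS)[i iJ Fi]; apply/bigcupP.
    by exists i; rewrite // finset.inE xS.
  exact: card_bigcup_le.
rewrite natr_sum mulr_natl -sumr_const; exact: ler_sum.
Qed.

(** * Lifts of complete graphs and their relabellings *)

Lemma set2_eqP (T : finType) (x y x' y' : T) :
  [set x; y]%SET = [set x'; y']%SET ->
  (x = x' /\ y = y') \/ (x = y' /\ y = x').
Proof.
move=> E.
have := set21 x y; have := set22 x y; have := set21 x' y'; have := set22 x' y'.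
rewrite E -{1 2}E !inE.
by do 4![case/orP => /eqP ?]; subst; auto.
Qed.

Lemma adjC (T : finType) (G : {set {set T}}) : symmetric (adj G).
Proof. by move=> x y; rewrite /adj eq_sym finset.setUC. Qed.

Lemma adj_complete (V : finType) (u v : V) :
  adj (complete_graph V) u v = (u != v).
Proof.
by rewrite /adj inE cards2; case: (u != v).
Qed.

Section Lifts.

Variables (V : finType) (l : nat).
Local Notation vert := (V * 'I_l)%type.
Local Notation KV := (complete_graph V).
Implicit Types (G : {set {set vert}}) (x y : vert).

Lemma card_fiber_nbrs G x v :
  #|[set y in fiber l v | adj G x y]%SET| = #|[set j | adj G x (v, j)]%SET|.
Proof.
rewrite -(@card_imset _ _ (fun j : 'I_l => (v, j))); last by move=> i j [].
apply: eq_card => -[u j]; rewrite !inE /=; apply/andP/imsetP.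
  by case=> /eqP -> a; exists j; rewrite ?inE.
by case=> k; rewrite inE => a [-> ->].
Qed.

Lemma liftP G :
  reflect [/\ simple_graph G, forall x y, adj G x y -> x.1 != y.1 &
           forall x v, x.1 != v -> #|[set j | adj G x (v, j)]%SET| = 1]
          (G \in lifts KV l).
Proof.
rewrite inE /is_lift; apply: (iffP and3P) => -[sG aG mG]; split => //.
- by move=> x y a; move/'forall_forallP: aG => /(_ x y); rewrite a adj_complete.
- move=> x v xv; move/'forall_forallP: mG => /(_ x.1 v).
  rewrite adj_complete xv => /andP[/'forall_implyP/(_ x) + _].
  by rewrite inE eqxx card_fiber_nbrs => /(_ isT)/eqP.
- apply/'forall_forallP => x y; apply/implyP => a.
  by rewrite adj_complete aG.
- apply/'forall_forallP => u v; rewrite adj_complete; apply/implyP => uv.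
  apply/andP; split; apply/'forall_implyP => x; rewrite inE => /eqP xu.
    by rewrite card_fiber_nbrs mG // xu.
  under eq_finset do rewrite adjC.
  by rewrite card_fiber_nbrs mG // xu eq_sym.
Qed.

(** The index of the neighbour of [x] in the fiber of [v].  With the default
[x.2], the map [fun i => nbr G (u, i) v] is a permutation also when [u = v]. *)
Definition nbr G x v : 'I_l := odflt x.2 [pick j | adj G x (v, j)].

Lemma adj_nbr G x y : G \in lifts KV l ->
  adj G x y = (x.1 != y.1) && (y.2 == nbr G x y.1).
Proof.
case/liftP => _ aG mG; case: (boolP (x.1 != y.1)) => /= [xy|]; last first.
  by apply: contraNF; exact: aG.
have /eqP/cards1P[j Ej] := mG _ _ xy.
have a k : adj G x (y.1, k) = (k == j) by rewrite -finset.in_set1 -Ej inE.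
rewrite /nbr; case: pickP => [k|/(_ j)]; rewrite ?a ?eqxx // => /eqP -> /=.
by rewrite -a; case: y {xy Ej a}.
Qed.

Lemma nbr_self G u i : G \in lifts KV l -> nbr G (u, i) u = i.
Proof.
case/liftP => _ aG _; rewrite /nbr; case: pickP => //= j /aG /=.
by rewrite eqxx.
Qed.

Lemma nbrK G u i v : G \in lifts KV l -> nbr G (v, nbr G (u, i) v) u = i.
Proof.
move=> GL; have [->|uv] := eqVneq u v; first by rewrite !nbr_self.
have := adj_nbr (u, i) (v, nbr G (u, i) v) GL; rewrite /= eqxx uv adjC.
by rewrite adj_nbr // => /andP[_ /eqP].
Qed.

Lemma nbr_inj G u v : G \in lifts KV l -> injective (fun i => nbr G (u, i) v).
Proof. by move=> GL i j /(congr1 (fun k => nbr G (v, k) u)); rewrite !nbrK. Qed.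

Lemma adj_eq G G' : simple_graph G -> simple_graph G' -> adj G =2 adj G' -> G = G'.
Proof.
suff sub (H H' : {set {set vert}}) : simple_graph H -> adj H =2 adj H' -> H \subset H'.
  by move=> s s' E; apply/eqP; rewrite finset.eqEsubset !sub.
move=> sH E; apply/fintype.subsetP => e eH.
have /cards2P[x [y [xy ee]]] : #|e| == 2 by move/'forall_implyP: sH => /(_ e eH).
by have := E x y; rewrite /adj xy /= -ee eH => <-.
Qed.

(** Relabels the matching between the fibers of [u] and [v] at both ends, by
[th v u] on the fiber of [u] and by [th u v] on the fiber of [v].  Since every
fiber pair has its own two permutations, any family of matchings can be
randomised alone by putting identities elsewhere. *)
Definition twist (th : V -> V -> 'S_l) G : {set {set vert}} :=
  [set e | [exists x, exists y, [&& e == [set x; y]%SET, x.1 != y.1 &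
     adj G (x.1, th y.1 x.1 x.2) (y.1, th x.1 y.1 y.2)]]]%SET.

Lemma adj_twist th G x y : adj (twist th G) x y =
  (x.1 != y.1) && adj G (x.1, th y.1 x.1 x.2) (y.1, th x.1 y.1 y.2).
Proof.
rewrite {1}/adj inE; apply/andP/andP.
  case=> xy /existsP[x' /existsP[y' /and3P[/eqP e d a]]].
  case: (set2_eqP e) => -[-> ->]; first by rewrite d a.
  by rewrite eq_sym d adjC.
case=> d a; split; first by apply: contraNneq d => ->.
by apply/existsP; exists x; apply/existsP; exists y; rewrite eqxx d a.
Qed.

Lemma twist_lift th G : G \in lifts KV l -> twist th G \in lifts KV l.
Proof.
case/liftP => sG aG mG; apply/liftP; split.
- apply/'forall_implyP => e; rewrite inE.
  case/existsP=> x /existsP[y /and3P[/eqP -> d _]]; rewrite cards2.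
  by case: (eqVneq x y) d => [->|//]; rewrite eqxx.
- by move=> x y; rewrite adj_twist => /andP[].
- move=> x v xv; rewrite -(mG (x.1, th v x.1 x.2) v xv).
  rewrite -[RHS](card_preimset _ (@perm_inj _ (th x.1 v))).
  by apply: eq_card => j; rewrite !inE adj_twist /= xv.
Qed.

Lemma twistK th G : G \in lifts KV l ->
  twist (fun u v => (th u v)^-1)%g (twist th G) = G.
Proof.
move=> GL; have /liftP[sG aG _] := GL.
apply: adj_eq => // [|x y].
  by case/(twist_lift th)/(twist_lift (fun u v => (th u v)^-1)%g)/liftP: GL.
rewrite !adj_twist /= !permKV -!surjective_pairing.
by case: (boolP (adj G x y)) => [/aG ->|]; rewrite ?andbF.
Qed.

Lemma nbr_twist th G x v : G \in lifts KV l -> x.1 != v ->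
  nbr (twist th G) x v = (th x.1 v)^-1%g (nbr G (x.1, th v x.1 x.2) v).
Proof.
move=> GL xv; apply/esym/eqP.
have := adj_nbr x (v, (th x.1 v)^-1%g (nbr G (x.1, th v x.1 x.2) v)) (twist_lift th GL).
by rewrite /= xv /= => <-; rewrite adj_twist /= xv permKV adj_nbr //= xv eqxx.
Qed.

(** Each [twist (th a)] permutes the lifts, so the number of bad lifts equals
the average over [a] of the number of lifts with a bad twist; exchanging the two
sums reduces the probability over the lifts to one over [a] for a fixed lift. *)
Lemma twist_average (R : realType) (A : finType) (th : A -> V -> V -> 'S_l)
    (bad : {set {set vert}} -> bool) (q : R) : 0 < #|A| ->
  (forall G, G \in lifts KV l ->
     (#|[set a | bad (twist (th a) G)]%SET|%:R <= q * #|A|%:R)%R) ->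
  (#|[set G in lifts KV l | bad G]%SET|%:R <= q * #|lifts KV l|%:R)%R.
Proof.
move=> A0 H.
have inv a : #|[set G in lifts KV l | bad G]%SET| <=
             #|[set G in lifts KV l | bad (twist (th a) G)]%SET|.
  pose f := twist (fun u v => (th a u v)^-1)%g.
  have fK G : G \in lifts KV l -> twist (th a) (f G) = G.
    move=> GL; rewrite -[RHS](twistK (fun u v => (th a u v)^-1)%g GL).
    rewrite /f /twist; apply/finset.setP=> e; rewrite !inE.
    by do 2!(apply: eq_existsb => ?); rewrite !invgK.
  rewrite -(@card_in_imset _ _ f); last first.
    move=> G G' /setIdP[GL _] /setIdP[GL' _] /(congr1 (twist (th a))).
    by rewrite !fK.
  apply: subset_leq_card; apply/fintype.subsetP => _ /imsetP[G + ->].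
  by case/setIdP=> GL b; rewrite finset.inE fK // b andbT twist_lift.
have sw : \sum_(a : A) #|[set G in lifts KV l | bad (twist (th a) G)]%SET| =
  \sum_(G in lifts KV l) #|[set a | bad (twist (th a) G)]%SET|.
  under eq_bigr do rewrite -sum1_card big_mkcond.
  under [RHS]eq_bigr do rewrite -sum1_card big_mkcond.
  rewrite exchange_big /= [RHS]big_mkcond; apply: eq_bigr => G _ /=.
  under eq_bigr do rewrite finset.in_set.
  case: ifP => GL /=; last by rewrite big1.
  by apply: eq_bigr => a _; rewrite finset.in_set.
have A0' : (0 < #|A|%:R :> R)%R by rewrite ltr0n.
rewrite -(ler_pM2l A0').
apply: (@le_trans _ _ (\sum_(G in lifts KV l) #|[set a | bad (twist (th a) G)]%SET|)%:R%R).
  rewrite -natrM ler_nat -sw -sum_nat_const.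
  exact: leq_sum.
rewrite natr_sum; apply: (@le_trans _ _ (\sum_(G in lifts KV l) (q * #|A|%:R))%R).
  exact: ler_sum.
by rewrite sumr_const -[leLHS]mulr_natr mulrAC [leRHS]mulrC.
Qed.

End Lifts.

(** * What a topological clique forces on its branch vertices *)

Section BranchSets.

Variables (V : finType) (l : nat).
Local Notation vert := (V * 'I_l)%type.
Local Notation KV := (complete_graph V).
Implicit Types (G : {set {set vert}}) (B : {set vert}) (x y w : vert).

Definition branch_like G B : bool :=
  [forall w in ~: B, #|[set x in B | adj G w x]%SET| <= 2] &&
  [forall x in B, forall y in B,
     (x != y) ==> (#|[set w in ~: B | adj G w x && adj G w y]%SET| <= 1)].

Lemma card_nbrs G x : G \in lifts KV l ->
  #|[set y | adj G x y]%SET| = #|V|.-1.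
Proof.
move=> GL; rewrite -(cardC1 x.1).
rewrite -(@card_imset _ _ (fun v => (v, nbr G x v))); last by move=> u v [].
apply: eq_card => -[v j]; rewrite finset.inE adj_nbr //=; apply/andP/imsetP.
  by case=> xv /eqP ->; exists v; rewrite // inE eq_sym.
by case=> u; rewrite inE eq_sym => xu [-> ->].
Qed.

(** The paths ending at a branch vertex start with distinct edges, and there are
as many of them as edges at that vertex.  So an edge from a branch vertex to an
outer vertex [w] puts [w] on the path that starts with it, and since the paths
are disjoint, being adjacent to two branch vertices determines this path. *)
Lemma clique_branch_like m G : m = #|V| -> G \in lifts KV l ->
  has_topological_clique m G ->
  exists2 B : {set vert}, #|B| = m & branch_like G B.
Proof.
move=> mV GL [b [p [binj hp hk hd]]].
have neqP (i j : 'I_m) : i != j -> (i < j) || (j < i).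
  by rewrite -neq_ltn.
(* The path between b i and b j, oriented from b i. *)
pose sp (i j : 'I_m) := if i < j then p i j else rev (p j i).
have sp_path i j : i != j -> path (adj G) (b i) (rcons (sp i j) (b j)).
  move=> /neqP; rewrite /sp; case: ltngtP => //= ij _; first by case: (hp _ _ ij).
  have [+ _] := hp _ _ ij.
  have := rev_path (adj G) (b j) (rcons (p j i) (b i)).
  rewrite last_rcons belast_rcons rev_cons => -> h.
  by apply: sub_path h => ? ?; rewrite adjC.
have sp_notb i j k : i != j -> b k \notin sp i j.
  by move=> /neqP; rewrite /sp; case: ltngtP => // ij _; rewrite ?mem_rev hk.
have disj_lt (i j i' j' : 'I_m) w : i < j -> i' < j' -> w \in p i j -> w \in p i' j' ->
    (i, j) = (i', j').
  move=> ij ij' wp wp'; apply: contrapT => ne.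
  by have /hasPn/(_ w wp') := hd _ _ _ _ ij ij' ne; rewrite /= wp.
have sp_disj i j i' j' w : i != j -> i' != j' -> w \in sp i j ->
    w \in sp i' j' -> (i = i' /\ j = j') \/ (i = j' /\ j = i').
  move=> /neqP + /neqP; rewrite /sp.
  case: (ltngtP i j) => // ij _; case: (ltngtP i' j') => // ij' _;
    rewrite ?mem_rev => wp wp';
    by case: (disj_lt _ _ _ _ _ ij ij' wp wp') => ? ?; subst; auto.
(* The vertex that follows b i on the path towards b j. *)
pose nx i j := head (b j) (sp i j).
have nx_adj i j : i != j -> adj G (b i) (nx i j).
  by move=> /sp_path; rewrite /nx; case: (sp i j) => [|a s] /= /andP[].
have nxP i j : nx i j = b j \/ nx i j \in sp i j.
  by rewrite /nx; case: (sp i j) => [|a s] /=; [left | right; rewrite mem_head].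
have nx_inj i j k : i != j -> i != k -> nx i j = nx i k -> j = k.
  move=> ij ik; case: (nxP i j) (nxP i k) => [->|j1] [->|k1] E.
  - exact: binj.
  - by move: (sp_notb i k j ik); rewrite E k1.
  - by move: (sp_notb i j k ij); rewrite -E j1.
  - rewrite -E in k1; case: (sp_disj _ _ _ _ _ ij ik j1 k1) => -[] //.
    by move=> ik'; rewrite ik' eqxx in ik.
(* By counting, the injective map nx i reaches all n - 1 neighbours of b i. *)
have nx_onto i w : adj G (b i) w -> exists2 j, i != j & w = nx i j.
  have : nx i @: [set~ i]%SET = [set y | adj G (b i) y]%SET.
    apply/eqP; rewrite eqEcard; apply/andP; split.
      apply/fintype.subsetP => _ /imsetP[j + ->]; rewrite !inE => ji.
      by rewrite nx_adj // eq_sym.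
    rewrite card_nbrs // card_in_imset ?cardsC1 ?card_ord ?mV //.
    by move=> j k; rewrite !inE ![_ == i]eq_sym; exact: nx_inj.
  move/finset.setP/(_ w); rewrite inE => E a; move: E; rewrite a.
  by case/imsetP => j; rewrite !inE eq_sym => ij ->; exists j.
pose B := (b @: [set: 'I_m])%SET.
have BP x : x \in B -> exists i, x = b i by case/imsetP => i _ ->; exists i.
have key w i k : w \notin B -> i != k -> adj G w (b i) -> adj G w (b k) ->
    w = nx i k.
  have insp i' j' : i' != j' -> nx i' j' \notin B -> nx i' j' \in sp i' j'.
    case: (nxP i' j') => [-> _|//]; rewrite imset_f //.
  move=> wB ik; rewrite ![adj G w _]adjC => /nx_onto[j ij wj] /nx_onto[h kh wh].
  have wj1 : w \in sp i j by rewrite wj insp // -wj.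
  have wh1 : w \in sp k h by rewrite wh insp // -wh.
  case: (sp_disj _ _ _ _ _ ij kh wj1 wh1) => -[e1 e2]; last by rewrite -e2.
  by rewrite e1 eqxx in ik.
exists B; first by rewrite card_imset // cardsT card_ord.
apply/andP; split; apply/'forall_implyP => w.
  rewrite finset.inE => wB; rewrite leqNgt; apply/negP => /card_gt2P.
  case=> x [y [z [[]]]].
  rewrite !finset.inE => /andP[/BP[i ->] ai] /andP[/BP[j ->] aj].
  case/andP => /BP[k ->] ak [ij jk ki].
  have ij' : i != j by apply: contraNneq ij => ->.
  have ik' : i != k by rewrite eq_sym; apply: contraNneq ki => ->.
  have : nx i j = nx i k by rewrite -!(key w).
  by move/nx_inj => jk'; rewrite jk' ?eqxx in jk.
case/BP => i ->; apply/'forall_implyP => _ /BP[k ->]; apply/implyP => ik.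
have ik' : i != k by apply: contraNneq ik => ->.
rewrite -(cards1 (nx i k)); apply: subset_leq_card; apply/fintype.subsetP => z.
by rewrite !finset.inE => /and3P[zB ai ak]; rewrite -(key z).
Qed.

End BranchSets.

(** * Families of permutations with prescribed values *)

(** Induction on [k], with (k + 1)(1 + 1/l) <= k + 2 as long as k + 1 <= l. *)
Lemma expn_succ_le k l : k <= l -> l.+1 ^ k <= k.+1 * l ^ k.
Proof.
elim: k => // k IH kl; rewrite !expnS.
apply: (leq_trans (leq_mul (leqnn _) (IH (ltnW kl)))).
by rewrite !mulnA leq_mul2r; apply/orP; right; nia.
Qed.

(** Thus [r] prescribed values of a uniform permutation have probability at most
l^(-r/2).  The exponent r/2 is what makes one bound serve the whole range, from
l = 2 to r = l. *)
Lemma expn_le_ffact_sqr l r : r <= l -> l ^ r <= (l ^_ r) ^ 2.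
Proof.
elim: l r => [|l IH] [|r] //; rewrite ltnS => rl.
rewrite ffactSS expnMn [l.+1 ^ r.+1]expnS [l.+1 ^ 2]expnS expn1 -mulnA leq_mul2l /=.
apply: (leq_trans (expn_succ_le rl)).
by apply: leq_mul; [rewrite ltnS | exact: IH].
Qed.

Lemma expn_le_ffact l K k : k <= K -> (l - K) ^ k <= l ^_ k.
Proof.
elim: k => // k IH kK; rewrite ffactnSr expnSr leq_mul ?IH ?(ltnW kK) //.
by rewrite leq_sub2l // ltnW.
Qed.

(** Composing with the inverse of one such permutation maps all of them to
permutations that fix [D] pointwise. *)
Lemma card_perm_prescribed (T : finType) (D : {set T}) (g : T -> T) :
  #|[set s : {perm T} | [forall i in D, s i == g i]]%SET| <= (#|T| - #|D|)`!.
Proof.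
have [->|[s0]] := set_0Vmem [set s : {perm T} | [forall i in D, s i == g i]]%SET.
  by rewrite finset.cards0.
rewrite finset.inE => /'forall_implyP s0g.
have <- : #|~: D| = #|T| - #|D| by rewrite -(cardsC D) addKn.
rewrite -card_perm -(@card_imset _ _ (fun s => s * s0^-1)%g); last exact: mulIg.
apply: subset_leq_card; apply/fintype.subsetP => _ /imsetP[s + ->].
rewrite finset.inE => /'forall_implyP sg.
apply/fintype.subsetP => i; rewrite !inE permM; apply: contra => iD.
by rewrite (eqP (sg i iD)) -(eqP (s0g i iD)) permK.
Qed.

Lemma card_ffun_all (E T : finType) (F : E -> {set T}) :
  #|[set a : {ffun E -> T} | [forall e, a e \in F e]]%SET| = \prod_e #|F e|.
Proof.
rewrite cardsE; have := card_family (fun e => mem (F e)); rewrite foldrE big_map big_enum => <-.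
by apply: eq_card => a.
Qed.

Section PrescribedFamily.
Variables (E T : finType) (D : E -> {set T}) (g : E -> T -> T).

Definition prescribed : {set {ffun E -> {perm T}}} :=
  [set a : {ffun E -> {perm T}} | [forall e, forall i in D e, a e i == g e i]].

Lemma card_prescribed : #|prescribed| <= \prod_e (#|T| - #|D e|)`!.
Proof.
rewrite (_ : prescribed = [set a : {ffun E -> {perm T}} | [forall e, a e \in
   [set s : {perm T} | [forall i in D e, s i == g e i]]]]%SET).
  rewrite card_ffun_all; apply: leq_prod => e _; exact: card_perm_prescribed.
by apply/finset.setP => a; rewrite !finset.inE; apply: eq_forallb => e;
  rewrite finset.inE.
Qed.

Lemma card_ffun_perm : #|{ffun E -> {perm T}}| = \prod_(e : E) (#|T|)`!.
Proof.
have cT : #|{perm T}| = (#|T|)`!.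
  by rewrite -cardsT -(card_perm [set: T]); apply: eq_card => s; rewrite !inE; apply/esym/fintype.subsetP.
by rewrite card_ffun cT prod_nat_const.
Qed.

(** Compared with independent uniform values, injectivity costs only a factor
|T| / (|T| - K) per prescribed value. *)
Lemma prescribed_le K : (forall e, #|D e| <= K) ->
  #|prescribed| * (#|T| - K) ^ (\sum_e #|D e|) <= #|{ffun E -> {perm T}}|.
Proof.
move=> DK; rewrite expn_sum card_ffun_perm.
apply: (leq_trans (leq_mul card_prescribed (leqnn _))).
rewrite -big_split /=; apply: leq_prod => e _.
rewrite -(@ffact_fact #|T| #|D e|) ?max_card // mulnC leq_mul2r.
by rewrite expn_le_ffact ?orbT.
Qed.

Lemma prescribed_sqr_le :
  #|prescribed| ^ 2 * #|T| ^ (\sum_e #|D e|) <= #|{ffun E -> {perm T}}| ^ 2.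
Proof.
rewrite expn_sum card_ffun_perm.
apply: (@leq_trans ((\prod_e (#|T| - #|D e|)`!) ^ 2 * \prod_e #|T| ^ #|D e|)).
  by rewrite leq_mul2r leq_exp2r // card_prescribed orbT.
have sq (F : E -> nat) : (\prod_e F e) ^ 2 = \prod_e F e ^ 2.
  by elim/big_rec2: _ => // e x y _ <-; rewrite expnMn.
rewrite !sq -big_split /=; apply: leq_prod => e _.
rewrite -[in leqRHS](@ffact_fact #|T| #|D e|) ?max_card // mulnC expnMn.
by rewrite leq_mul2r expn_le_ffact_sqr ?orbT ?max_card.
Qed.

End PrescribedFamily.

(** * Edges between the branch vertices *)

Section InnerEdges.

Variables (n l : nat).
Local Notation vert := ('I_n * 'I_l)%type.
Local Notation Kn := (complete_graph 'I_n).
Implicit Types (G : {set {set vert}}) (B : {set vert}).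

(** Ordering the fibers picks one orientation of every pair of vertices that can
be adjacent. *)
Definition inner_pairs B : {set vert * vert} :=
  [set xy | [&& xy.1 \in B, xy.2 \in B & (xy.1.1 < xy.2.1)%N]]%SET.

Definition edge_pairs G : {set vert * vert} :=
  [set xy : vert * vert | (xy.1.1 < xy.2.1)%N && adj G xy.1 xy.2]%SET.

Definition inner_edges G B : {set vert * vert} := inner_pairs B :&: edge_pairs G.

Lemma card_inner_pairs B : 2 * #|inner_pairs B| <= #|B| * #|B|.-1.
Proof.
pose sw (xy : vert * vert) := (xy.2, xy.1).
pose diag := [set (x, x) | x in B]%SET.
have cd : #|diag| = #|B| by rewrite card_imset // => x y [].
have swi : injective sw by move=> [a b] [c d] [-> ->].
have sub : inner_pairs B :|: (sw @: inner_pairs B) :|: diag \subset finset.setX B B.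
  apply/fintype.subsetP => -[x y]; rewrite !finset.inE /= => /orP[/orP[]|].
  - by case/and3P => -> ->.
  - by case/imsetP => -[a b]; rewrite finset.inE /= => /and3P[aB bB _] [-> ->]; rewrite aB bB.
  - by case/imsetP => a aB [-> ->]; rewrite aB.
have := subset_leq_card sub; rewrite cardsX !cardsU card_imset // cd.
have -> : inner_pairs B :&: (sw @: inner_pairs B) = finset.set0.
  apply/finset.setP => -[x y]; rewrite !finset.inE /=; apply/negP.
  case/andP => /and3P[_ _ xy] /imsetP[[a b]]; rewrite finset.inE /= => /and3P[_ _ ab] [E F].
  by move: xy ab; rewrite E F /=; lia.
have -> : (inner_pairs B :|: (sw @: inner_pairs B)) :&: diag = finset.set0.
  apply/finset.setP => -[x y]; rewrite !finset.inE /=; apply/negP.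
  case/andP => h /imsetP[z _ [E F]]; rewrite E F in h.
  case/orP: h => [/and3P[_ _]|]; first by rewrite ltnn.
  case/imsetP=> -[a b]; rewrite finset.inE /= => /and3P[_ _ ab] [E' F'].
  by move: ab; rewrite -E' -F' ltnn.
rewrite !finset.cards0 !subn0; move: #|B| #|inner_pairs B| => b X; rewrite addnn -mul2n; case: b => [|b] /=; nia.
Qed.

(** Relabels each matching at one end only, the fiber with the larger index. *)
Definition upward (a : {ffun 'I_n * 'I_n -> 'S_l}) (u v : 'I_n) : 'S_l :=
  if (u < v)%N then a (u, v) else 1%g.

(** An edge of [M] between [(u, i)] and [(v, j)], with u < v, is present in the
twisted lift only if [a (u, v)] sends [j] to the neighbour of [(u, i)] in the
original lift, so [M] prescribes |M| values of the permutations. *)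
Lemma card_upward_edges G (M : {set vert * vert}) : G \in lifts Kn l ->
  #|[set a | M \subset edge_pairs (twist (upward a) G)]%SET| ^ 2 * l ^ #|M|
    <= #|{ffun 'I_n * 'I_n -> 'S_l}| ^ 2.
Proof.
move=> GL; set S := finset _.
have [->|[a0]] := set_0Vmem S; first by rewrite finset.cards0.
rewrite finset.inE => /fintype.subsetP Ma0.
pose D (e : 'I_n * 'I_n) := [set j | [exists i, ((e.1, i), (e.2, j)) \in M]]%SET.
(* As soon as M occurs in one twisted lift, it is a matching between any two
   fibers, so the pair (i, j) in M can be recovered from j. *)
pose g (e : 'I_n * 'I_n) (j : 'I_l) :=
  nbr G (e.1, odflt j [pick i | ((e.1, i), (e.2, j)) \in M]) e.2.
have -> : #|M| = \sum_e #|D e|.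
  pose f (xy : vert * vert) := ((xy.1.1, xy.2.1), xy.2.2).
  have fi : {in M &, injective f}.
    move=> [[u i] [v j]] [[u' i'] [v' j']] /Ma0 + /Ma0.
    rewrite !finset.inE /f /= => /andP[_ h] /andP[_ h'] [? ? ?]; subst.
    move: h h'; rewrite ![adj _ (u', _) _]adjC !adj_nbr ?twist_lift //=.
    by move=> /andP[_ /eqP ->] /andP[_ /eqP ->].
  rewrite -(card_in_imset fi) sum_card_pairs; apply: eq_card => -[[u v] j] /=.
  rewrite !finset.inE /=; apply/imsetP/existsP.
    by case=> -[[u' i'] [v' j']] h [-> -> ->]; exists i'.
  by case=> i h; exists ((u, i), (v, j)).
apply: leq_trans (prescribed_sqr_le D g).
rewrite card_ord leq_mul2r leq_exp2r //; apply/orP; right.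
apply: subset_leq_card; apply/fintype.subsetP => a.
rewrite !finset.inE => /fintype.subsetP Ma; apply/forallP => -[u v].
apply/'forall_implyP => j; rewrite finset.inE /g /= => /existsP[i0].
case: pickP => [i /Ma|/(_ i0) ->//]; rewrite finset.inE /= => /andP[uv] + _.
rewrite adj_twist /= adj_nbr // => /and3P[_ _ /eqP].
by rewrite /upward uv ltnNge (ltnW uv) /= perm1 => ->.
Qed.

(** A union bound over the sets of [m] pairs.  The condition on [q] says that [q]
is at least l^(-m/2), without square roots. *)
Lemma inner_edges_prob (R : realType) B m (q : R) :
  (0 <= q)%R -> (1 <= q ^+ 2 * l%:R ^+ m)%R ->
  (#|[set G in lifts Kn l | (m <= #|inner_edges G B|)%N]%SET|%:R <=
   'C(#|inner_pairs B|, m)%:R * q * #|lifts Kn l|%:R)%R.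
Proof.
move=> q0 q1; rewrite -cards_draws -mulrA.
apply: (union_bound (Q := fun G => m <= #|inner_edges G B|)
  (F := fun (M : {set vert * vert}) G => M \subset edge_pairs G)) => [G GL|M].
  case/subset_of_card => M; rewrite finset.subsetI => /andP[MB MG] Mm.
  by exists M; rewrite // finset.inE MB Mm /=.
rewrite finset.inE => /andP[_ /eqP Mm].
apply: (twist_average (th := upward)).
  by rewrite card_ffun_perm prodn_gt0 // => e; exact: fact_gt0.
move=> G GL; have := card_upward_edges M GL; rewrite Mm.
rewrite -(ler_nat R) natrM !natrX => h.
rewrite -ler_sqr ?nnegrE ?mulr_ge0 // exprMn.
apply: (le_trans _ (ler_wpM2l (sqr_ge0 q) h)).
by rewrite mulrCA ler_peMr // exprn_ge0.
Qed.

Lemma adj_pairs_le G B : G \in lifts Kn l ->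
  #|[set xy : vert * vert | [&& xy.1 \in B, xy.2 \in B & adj G xy.1 xy.2]]%SET|
    <= 2 * #|inner_edges G B|.
Proof.
move=> GL; pose sw (xy : vert * vert) := (xy.2, xy.1).
have swi : injective sw by move=> [a b] [c d] [-> ->].
rewrite mul2n -addnn -[X in _ + X](card_imset _ swi).
apply: leq_trans (leq_card_setU _ _).
apply: subset_leq_card; apply/fintype.subsetP => -[x y].
rewrite !finset.inE /= => /and3P[xB yB a]; rewrite xB yB a /= !andbT.
have /liftP[_ /(_ x y a) + _] := GL; rewrite -(inj_eq val_inj) neq_ltn.
case/orP => [->//|yx]; apply/orP; right; apply/imsetP; exists (y, x) => //.
by rewrite !finset.inE /= yB xB yx adjC.
Qed.

(** Each vertex of [B] has degree n - 1, and the n l - n vertices outside [B]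
absorb at most two edges each. *)
Lemma inner_edges_lower G B : G \in lifts Kn l -> #|B| = n -> branch_like G B ->
  n * n.-1 <= 2 * #|inner_edges G B| + 2 * (n * l - n).
Proof.
move=> GL Bn /andP[/'forall_implyP F1 _].
have -> : n * n.-1 = \sum_(x in B) #|[set y | adj G x y]%SET|.
  rewrite (eq_bigr (fun=> n.-1)) => [|x _]; first by rewrite sum_nat_const Bn.
  by rewrite card_nbrs // card_ord.
have -> : \sum_(x in B) #|[set y | adj G x y]%SET| =
  \sum_(x in B) #|[set y in B | adj G x y]%SET| +
  \sum_(x in B) #|[set y in ~: B | adj G x y]%SET|.
  rewrite -big_split; apply: eq_bigr => x _ /=.
  rewrite -(cardsID B); congr (_ + _); apply: eq_card => y;
  by rewrite !finset.inE andbC.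
have swap (A C : {set vert}) : \sum_(x in A) #|[set y in C | adj G x y]%SET| =
    #|[set xy : vert * vert | [&& xy.1 \in A, xy.2 \in C & adj G xy.1 xy.2]]%SET|.
  by rewrite sum_card_pairs; apply: eq_card => -[x y]; rewrite !finset.inE.
apply: leq_add; first by rewrite swap; exact: adj_pairs_le.
have -> : \sum_(x in B) #|[set y in ~: B | adj G x y]%SET| =
  \sum_(w in ~: B) #|[set x in B | adj G w x]%SET|.
  under eq_bigr do rewrite -sum1_card.
  under [RHS]eq_bigr do rewrite -sum1_card.
  rewrite (exchange_big_dep (mem (~: B))) /=; last first.
    by move=> x y _; rewrite finset.in_set => /andP[].
  apply: eq_bigr => y yB; apply: eq_bigl => x.
  by rewrite !finset.in_set -finset.in_setC yB adjC.
have -> : n * l - n = #|~: B|.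
  by rewrite cardsCs finset.setCK Bn card_prod !card_ord.
by rewrite mulnC -sum_nat_const; exact: leq_sum.
Qed.

End InnerEdges.

(** * A birthday problem *)

(** It follows from 1 + x <= exp x, as 1 / (1 + a t) = 1 - a t / (1 + a t) and
t <= 2. *)
Lemma expRN_le (R : realType) (a t : R) : (0 <= a -> 0 <= t -> t <= 2 ->
  expR (- (a * t)) <= 1 - a / (1 + 2 * a) * t)%R.
Proof.
move=> a0 t0 t2; have at0 : (0 <= a * t)%R by rewrite mulr_ge0.
apply: (@le_trans _ _ (1 + a * t)^-1)%R.
  rewrite expRN lef_pV2 ?posrE ?expR_gt0 ?expR_ge1Dx //; lra.
have p1 : (0 < 1 + a * t)%R by lra.
have p2 : (0 < 1 + 2 * a)%R by lra.
rewrite -div1r ler_pdivrMr // mulrAC.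
rewrite -[X in (X <= _)%R](mulfK (lt0r_neq0 p2)) -subr_ge0.
rewrite (_ : _ - _ = a * t * (a * (2 - t)) / (1 + 2 * a))%R; last first.
  by field; rewrite lt0r_neq0.
by rewrite divr_ge0 ?mulr_ge0 // ?subr_ge0 // ltW.
Qed.

(** A function [f] chooses one of [l] slots for every index [v], and slot [i] of
[v] shows the set [N v i] of at most two elements of [X].  The number of [f] for
which the sets shown by distinct indices of [T1] and [T2] are disjoint is to be
bounded. *)
Section Collisions.

Variables (R : realType) (I T : finType) (l : nat) (X : {set T}).
Variables (N : I -> 'I_l -> {set T}) (T1 T2 : {set I}).
Hypothesis l_gt0 : 0 < l.
Hypothesis card_N : forall v i, #|N v i| <= 2.
Hypothesis N_sub : forall v i, N v i \subset X.
Hypothesis T12 : [disjoint T1 & T2].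

Definition missed v : nat := #|X :\: \bigcup_i N v i|.

Definition collision_free (f : {ffun I -> 'I_l}) : bool :=
  [forall v in T1 :|: T2, forall w in T1 :|: T2,
     (v != w) ==> [disjoint N v (f v) & N w (f w)]].

Definition merge (f g : {ffun I -> 'I_l}) : {ffun I -> 'I_l} :=
  [ffun v => if v \in T1 then f v else g v].

(** Exchanging the values outside [T1] is a bijection on pairs of functions.  So
the values on [T1] can be drawn first and the others independently of them. *)
Lemma sum_collision_free_merge :
  #|{ffun I -> 'I_l}| * #|[set f | collision_free f]%SET| =
  \sum_(f : {ffun I -> 'I_l}) #|[set g | collision_free (merge f g)]%SET|.
Proof.
have sumE (P : {ffun I -> 'I_l} -> {ffun I -> 'I_l} -> bool) :
    \sum_f #|[set g | P f g]%SET| = \sum_(fg | P fg.1 fg.2) 1.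
  under eq_bigr do rewrite -sum1_card.
  rewrite pair_big_dep /=; apply: eq_bigl => -[f g] /=; by rewrite finset.inE.
rewrite sumE -sum_nat_const (sumE (fun=> collision_free)).
pose phi fg := (merge fg.2 fg.1, merge fg.1 fg.2).
have phiK : involutive phi.
  move=> [f g]; rewrite /phi /=; congr (_, _); apply/ffunP => v; by rewrite !ffunE; case: (v \in T1).
by rewrite (reindex_inj (inv_inj phiK)).
Qed.

Definition hits f : {set T} := \bigcup_(v in T1) N v (f v).

(** Apart from the missed elements, each element of [D] blocks a slot of [v], and
a slot is blocked by at most two of them. *)
Lemma card_free_slots (D : {set T}) v : D \subset X ->
  (#|[set i | [disjoint N v i & D]]%SET|%:R <=
   l%:R * expR (- ((#|D|%:R - (missed v)%:R) / (2 * l%:R))) :> R)%R.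
Proof.
move=> DX.
have l0 : (0 < l%:R :> R)%R by rewrite ltr0n.
apply: (@le_trans _ _ (l%:R * (1 - (#|D|%:R - (missed v)%:R) / (2 * l%:R))))%R; last first.
  by rewrite ler_pM2l // expR_ge1Dx.
rewrite mulrBr mulr1 (_ : l%:R * _ = (#|D|%:R - (missed v)%:R) / 2 :> R)%R; last first.
  by field; rewrite lt0r_neq0.
set A := finset _.
have h : #|D| <= missed v + 2 * #|~: A|.
  have -> : 2 * #|~: A| = \sum_(i in ~: A) 2 by rewrite sum_nat_const mulnC.
  rewrite -(cardsID (\bigcup_i N v i) D) addnC; apply: leq_add.
    by apply: subset_leq_card; exact: finset.setSD.
  apply: (@leq_trans (#|\bigcup_(i in ~: A) N v i|)).
    apply: subset_leq_card; apply/fintype.subsetP => x /finset.setIP[xD].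
    case/bigcupP => i _ xi; apply/bigcupP; exists i => //.
    rewrite !finset.inE; apply/negP => /pred0P/(_ x) /=.
    by rewrite xi xD.
  by apply: (leq_trans (card_bigcup_le _ _)); apply: leq_sum.
have := cardsC A; rewrite card_ord => AC.
have {}h : (#|D|%:R <= (missed v)%:R + 2 * #|~: A|%:R :> R)%R.
  by rewrite -natrM -natrD ler_nat.
have {}AC : (#|A|%:R + #|~: A|%:R = l%:R :> R)%R by rewrite -natrD AC.
lra.
Qed.

Variables (a : R).
Hypothesis a_ge0 : (0 <= a)%R.
Hypothesis a_le : (2 * l%:R * a <= #|T2|%:R)%R.

(** Once [f] is collision free on [T1], it has hit as many elements of [X] as its
slots there show, and every index of [T2] has to avoid all of them. *)
Lemma card_collision_free_merge f :
  (#|[set g | collision_free (merge f g)]%SET|%:R <=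
   #|{ffun I -> 'I_l}|%:R * expR ((\sum_(v in T2) missed v)%:R / (2 * l%:R))
   * expR (- (a * (\sum_(v in T1) #|N v (f v)|)%:R)) :> R)%R.
Proof.
set S := finset _; have [->|[g0]] := set_0Vmem S.
  by rewrite finset.cards0 !mulr_ge0 ?expR_ge0.
rewrite finset.inE => /'forall_implyP cf0.
have hE : \sum_(v in T1) #|N v (f v)| <= #|hits f|.
  rewrite sum_card_pairs.
  rewrite -(card_in_imset (f := snd)).
    apply: subset_leq_card; apply/fintype.subsetP => y /imsetP[[v x]].
    by rewrite finset.inE /= => /andP[vT xN] ->; apply/bigcupP; exists v.
  move=> [v x] [w y]; rewrite !finset.inE /= => /andP[vT xN] /andP[wT yN] xy.
  subst y; congr (_, _); apply: contraTeq isT => vw.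
  have := cf0 v; rewrite finset.inE vT => /(_ isT)/'forall_implyP/(_ w).
  by rewrite finset.inE wT vw !ffunE vT wT => /(_ isT)/pred0P/(_ x); rewrite /= xN yN.
have hX : hits f \subset X by apply/bigcupsP => v _.
pose A v := if v \in T2 then [set i | [disjoint N v i & hits f]]%SET else [set: 'I_l].
have cS : #|S| <= \prod_v #|A v|.
  rewrite -card_ffun_all; apply: subset_leq_card; apply/fintype.subsetP => g.
  rewrite !finset.inE => /'forall_implyP cf; apply/forallP => v; rewrite /A.
  case: ifP => vT2; rewrite finset.inE //; apply: bigcup_disjoint => w wT.
  have vT : v \in T1 = false by rewrite (disjointFl T12 vT2).
  have vw : v != w by apply: contraFneq vT => ->.
  have := cf v; rewrite finset.inE vT2 orbT => /(_ isT)/'forall_implyP/(_ w).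
  by rewrite finset.inE wT vw !ffunE vT wT; apply.
apply: (@le_trans _ _ (\prod_v (#|A v|)%:R)%R); first by rewrite -natr_prod ler_nat.
apply: (@le_trans _ _ (\prod_v (l%:R * (if v \in T2 then expR (- ((#|hits f|%:R - (missed v)%:R) / (2 * l%:R))) else 1)))%R).
  apply: ler_prod => v _; rewrite ler0n /= /A; case: ifP => _.
    exact: card_free_slots.
  by rewrite cardsT card_ord mulr1.
rewrite big_split /= prodr_const -natrX card_ffun card_ord -mulrA ler_wpM2l //.
rewrite -big_mkcond /= -expR_sum -expRD ler_expR.
have l0 : (0 < 2 * l%:R :> R)%R by rewrite mulr_gt0 ?ltr0n.
rewrite sumrN -mulr_suml sumrB sumr_const natr_sum.
have {}hE : ((\sum_(v in T1) #|N v (f v)|)%:R <= #|hits f|%:R :> R)%R by rewrite ler_nat.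
have h2 : (a * (\sum_(v in T1) #|N v (f v)|)%:R <= #|hits f|%:R * #|T2|%:R / (2 * l%:R))%R.
  rewrite ler_pdivlMr //.
  apply: (le_trans (ler_wpM2r (ltW l0) (ler_wpM2l a_ge0 hE))).
  by rewrite mulrAC mulrC ler_wpM2l // mulrC.
rewrite mulrBl opprB -natr_sum lerD2l lerN2 -[X in (_ <= X / _)%R]mulr_natr; exact: h2.
Qed.

(** Averaging the previous bound over [f]: the weight exp(-a h) of [h] hits is
multiplicative over [T1], and so its average is a product over the indices. *)
Lemma card_collision_free (D : R) :
  ((\sum_(v in T1 :|: T2) missed v)%:R <= D)%R ->
  (#|[set f | collision_free f]%SET|%:R <= #|{ffun I -> 'I_l}|%:R *
     expR (D / (2 * l%:R) -
           a / (1 + 2 * a) * (#|X|%:R * #|T1|%:R - D) / l%:R))%R.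
Proof.
move=> missD; set c := (a / (1 + 2 * a))%R.
have c0 : (0 <= c)%R by rewrite divr_ge0 // addr_ge0 ?mulr_ge0.
have l0 : (0 < l%:R :> R)%R by rewrite ltr0n.
have L0 : (0 < #|{ffun I -> 'I_l}|%:R :> R)%R.
  by rewrite ltr0n card_ffun card_ord expn_gt0 l_gt0.
have [m1 m2] : ((\sum_(v in T1) missed v)%:R <= D)%R /\ ((\sum_(v in T2) missed v)%:R <= D)%R.
  split; apply: (le_trans _ missD); rewrite ler_nat big_mkcond [leqRHS]big_mkcond /=;
  apply: leq_sum => v _; rewrite finset.inE; case: (v \in T1); case: (v \in T2) => //.
rewrite -(ler_pM2l L0) -[leLHS]natrM sum_collision_free_merge natr_sum.
apply: (le_trans (ler_sum _ (fun f _ => card_collision_free_merge f))).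
rewrite -mulr_sumr -[leLHS]mulrA ler_pM2l // expRD [leRHS]mulrCA ler_pM ?expR_ge0 //.
- by apply: sumr_ge0 => f _; exact: expR_ge0.
- by rewrite ler_expR ler_pM2r // invr_gt0 mulr_gt0.
pose w v i : R := if v \in T1 then expR (- (a * #|N v i|%:R)) else 1%R.
have -> : (\sum_(f : {ffun I -> 'I_l}) expR (- (a * (\sum_(v in T1) #|N v (f v)|)%:R)) =
  \prod_v \sum_i w v i)%R.
  rewrite bigA_distr_bigA; apply: eq_bigr => f _.
  by rewrite -big_mkcond /= natr_sum mulr_sumr -sumrN expR_sum.
apply: (@le_trans _ _ (\prod_v (l%:R * (if v \in T1 then expR (- (c * (#|X|%:R - (missed v)%:R) / l%:R)) else 1)))%R).
  apply: ler_prod => v _; apply/andP; split.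
    by apply: sumr_ge0 => i _; rewrite /w; case: ifP => _ //; exact: expR_ge0.
  rewrite /w; case: ifP => _; last by rewrite sumr_const card_ord mulr1.
  apply: (@le_trans _ _ (l%:R * (1 - c * (#|X|%:R - (missed v)%:R) / l%:R)))%R; last first.
    by rewrite ler_pM2l // expR_ge1Dx.
  apply: (@le_trans _ _ (\sum_(i < l) (1 - c * #|N v i|%:R)))%R.
    by apply: ler_sum => i _; rewrite expRN_le // ler_nat.
  rewrite sumrB sumr_const card_ord -mulr_sumr -natr_sum mulrBr mulr1.
  rewrite mulrCA mulfV ?lt0r_neq0 // mulr1 lerD2l lerN2 ler_wpM2l //.
  rewrite lerBlDl -natrD ler_nat -(cardsID (\bigcup_i N v i) X) addnC leq_add2l.
  apply: (@leq_trans #|\bigcup_i N v i|).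
    by apply: subset_leq_card; exact: finset.subsetIr.
  exact: card_bigcup_le.
rewrite big_split /= prodr_const -natrX card_ffun card_ord ler_wpM2l //.
rewrite -big_mkcond /= -expR_sum ler_expR sumrN -mulr_suml -mulr_sumr sumrB.
rewrite sumr_const -natr_sum lerN2 ler_pM2r ?invr_gt0 // ler_wpM2l //.
by rewrite -[X in (_ <= X - _)%R]mulr_natr lerD2l lerN2.
Qed.

End Collisions.

(** * Probing a branch set with few inner edges *)

(** The set [X] lies in fibers that contain no probe, and [T1] and [T2] consist of
fibers without probes, so the edges between [X] and these fibers are the same
in all the twisted lifts.  Only the edges at the probes are random. *)
Section Spread.

Variables (R : realType) (n l K m : nat).
Local Notation vert := ('I_n * 'I_l)%type.
Local Notation Kn := (complete_graph 'I_n).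
Variables (B X : {set vert}) (probe : 'I_K -> vert) (T1 T2 : {set 'I_n}).
Hypothesis Kl : K < l.
Hypothesis Bn : #|B| <= n.
Hypothesis XB : X \subset B.
Hypothesis probe_B : forall k, probe k \in B.
Hypothesis probe_inj : injective probe.
Definition probe_fibers : {set 'I_n} := [set (probe k).1 | k in 'I_K]%SET.
Hypothesis X_probe_fibers : forall x, x \in X -> x.1 \notin probe_fibers.
Hypothesis T12_probe_fibers : forall v, v \in T1 :|: T2 -> v \notin probe_fibers.
Hypothesis T12 : [disjoint T1 & T2].

Local Notation A := {ffun 'I_n * 'I_n -> 'S_l}.
Implicit Types (G : {set {set vert}}) (a : A).

Definition probe_twist a (u v : 'I_n) : 'S_l :=
  if (u \in probe_fibers) && (v \notin probe_fibers) then a (u, v) else 1%g.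

Definition sparse_branch G := branch_like G B && (#|inner_edges G B| <= m).

(** The neighbours in [X] of the slot [(v, i)].  Slots in [B], where common
neighbours of branch vertices are unrestricted, and slots in the fibers of the
probes are treated as blank. *)
Definition slot_nbrs G (v : 'I_n) (i : 'I_l) : {set vert} :=
  if (v \in probe_fibers) || ((v, i) \in B) then finset.set0
  else [set x in X | adj G (v, i) x]%SET.

(** The slot in each fiber that is adjacent to a given probe in the twisted lift.
In the fiber of the probe itself the value is meaningless, but as uniform as the
others, which avoids restricting the index [v]. *)
Definition landing G a (k : 'I_K) : {ffun 'I_n -> 'I_l} :=
  [ffun v => (a ((probe k).1, v))^-1%g (nbr G (probe k) v)].

Lemma adj_probe_twist G a v i x : v \notin probe_fibers -> x \in X ->
  adj (twist (probe_twist a) G) (v, i) x = (v != x.1) && adj G (v, i) x.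
Proof.
move=> vP xX; rewrite adj_twist /probe_twist /= (negbTE vP) (negbTE (X_probe_fibers xX)) /=.
by rewrite !perm1 -surjective_pairing.
Qed.

Lemma adj_landing G a k v : G \in lifts Kn l -> v \notin probe_fibers ->
  adj (twist (probe_twist a) G) (v, landing G a k v) (probe k).
Proof.
move=> GL vP; have kP : (probe k).1 \in probe_fibers by apply/imsetP; exists k.
have vk : (probe k).1 != v by apply: contraNneq vP => <-.
rewrite adjC adj_nbr ?twist_lift //= vk /= nbr_twist // ffunE.
by rewrite /probe_twist kP (negbTE vP) /= perm1 -surjective_pairing.
Qed.

Lemma card_slot_nbrs G a v i : G \in lifts Kn l ->
  branch_like (twist (probe_twist a) G) B -> #|slot_nbrs G v i| <= 2.
Proof.
move=> GL /andP[/'forall_implyP/(_ (v, i)) F1 _].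
rewrite /slot_nbrs; case: ifPn; first by rewrite finset.cards0.
rewrite negb_or => /andP[vP vB].
apply: (leq_trans _ (F1 _)); last by rewrite finset.inE.
apply: subset_leq_card; apply/fintype.subsetP => x.
rewrite !finset.inE => /andP[xX ax]; rewrite (fintype.subsetP XB x xX) /=.
rewrite adj_probe_twist // ax andbT.
by have /liftP[_ /(_ _ _ ax)] := GL.
Qed.

(** An element of [X] is invisible from the fiber of [v] only if it lies in that
fiber, or if its neighbour there belongs to [B].  The latter pairs are edges
inside [B]. *)
Lemma sum_missed G a : G \in lifts Kn l ->
  #|inner_edges (twist (probe_twist a) G) B| <= m ->
  \sum_(v in T1 :|: T2) missed X (slot_nbrs G) v <= n + 2 * m.
Proof.
move=> GL Em; set G' := twist _ G in Em.
have GL' : G' \in lifts Kn l by exact: twist_lift.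
rewrite /missed sum_card_pairs.
pose S1 := [set (x.1, x) | x in B]%SET.
pose S2 := [set xy : vert * vert | [&& xy.1 \in B, xy.2 \in B & adj G' xy.1 xy.2]]%SET.
pose S3 := [set (xy.1.1, xy.2) | xy in S2]%SET.
apply: (@leq_trans #|S1 :|: S3|).
  apply: subset_leq_card; apply/fintype.subsetP => -[v x].
  rewrite finset.inE /= => /andP[vT /setDP[xX /bigcupP xN]].
  have xB := fintype.subsetP XB x xX.
  rewrite finset.inE; have [<-|xv] := eqVneq x.1 v.
    by apply/orP; left; apply/imsetP; exists x.
  apply/orP; right; apply/imsetP.
  exists ((v, nbr G' x v), x) => //; rewrite finset.inE /= xB /=.
  have ax : adj G' (v, nbr G' x v) x by rewrite adjC adj_nbr // xv /=.
  rewrite ax andbT; apply: contraT => vB; case: xN; exists (nbr G' x v) => //.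
  rewrite /slot_nbrs (negbTE vB) (negbTE (T12_probe_fibers vT)) /= finset.inE xX /=.
  by move: ax; rewrite adj_probe_twist ?T12_probe_fibers // => /andP[].
apply: (leq_trans (leq_card_setU _ _)); apply: leq_add.
  exact: (leq_trans (leq_imset_card _ _)).
apply: (leq_trans (leq_imset_card _ _)); apply: (leq_trans (adj_pairs_le _ GL')).
by rewrite leq_mul2l Em orbT.
Qed.

(** A vertex of [X] shown by two slots adjacent to the same probe would have two
common neighbours with that probe outside [B]. *)
Lemma landing_collision_free G a k : G \in lifts Kn l ->
  branch_like (twist (probe_twist a) G) B ->
  collision_free (slot_nbrs G) T1 T2 (landing G a k).
Proof.
move=> GL /andP[_ /'forall_implyP F2].
apply/'forall_implyP => v vT; apply/'forall_implyP => w wT.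
apply/implyP => vw; apply/pred0P => x /=; apply/negP => /andP[].
rewrite /slot_nbrs; case: ifPn; first by rewrite finset.inE.
rewrite negb_or finset.inE => /andP[vP vB] /andP[xX vx].
case: ifPn; first by rewrite finset.inE.
rewrite negb_or finset.inE => /andP[wP wB] /andP[_ wx].
have xk : x != probe k.
  apply: contraNneq (X_probe_fibers xX) => ->; apply/imsetP; by exists k.
have := F2 _ (fintype.subsetP XB _ xX) => /'forall_implyP/(_ _ (probe_B k)).
rewrite xk /= leqNgt => /negP; apply; apply/card_gt1P.
have neq u i : adj G (u, i) x -> u != x.1 by have /liftP[_ + _] := GL; move=> /[apply].
exists (v, landing G a k v), (w, landing G a k w); split.
- by rewrite !finset.inE vB adj_landing // adj_probe_twist // vx (neq _ _ vx).
- by rewrite !finset.inE wB adj_landing // adj_probe_twist // wx (neq _ _ wx).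
- by apply: contraNneq vw => -[->].
Qed.

(** Distinct probes land on distinct slots of a fiber, as each matching is
injective, so prescribing all the landings prescribes n K values. *)
Lemma card_landing G (F : 'I_K -> {ffun 'I_n -> 'I_l}) : G \in lifts Kn l ->
  #|[set a : A | [forall k, landing G a k == F k]]%SET| * (l - K) ^ (n * K)
    <= #|{ffun 'I_n * 'I_n -> 'S_l}|.
Proof.
move=> GL; set S := finset _.
have [->|[a0]] := set_0Vmem S; first by rewrite finset.cards0.
rewrite finset.inE => /forallP a0F.
have F_inj v j k : (probe j).1 = (probe k).1 -> F j v = F k v -> j = k.
  move=> jk; rewrite -(eqP (a0F j)) -(eqP (a0F k)) !ffunE jk => /perm_inj.
  move: jk (@probe_inj j k); case: (probe j) (probe k) => [u i] [u' i'] /= <- h.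
  by move/nbr_inj => -/(_ GL) e; apply: h; rewrite e.
pose D (e : 'I_n * 'I_n) := [set F k e.2 | k in 'I_K & (probe k).1 == e.1]%SET.
pose g (e : 'I_n * 'I_n) (j : 'I_l) :=
  if [pick k | ((probe k).1 == e.1) && (F k e.2 == j)] is Some k
  then nbr G (probe k) e.2 else j.
have -> : n * K = \sum_e #|D e|.
  rewrite sum_card_pairs.
  transitivity #|[set: 'I_n * 'I_K]|; first by rewrite cardsT card_prod !card_ord.
  pose f (vk : 'I_n * 'I_K) := (((probe vk.2).1, vk.1), F vk.2 vk.1).
  have fi : injective f.
    by move=> [v j] [w k] [yjk vw]; rewrite vw => /(F_inj _ _ _ yjk) ->.
  rewrite -(card_imset _ fi); apply: eq_card => -[[u v] j] /=.
  rewrite finset.inE /=; apply/imsetP/imsetP => [[[w k] _ [-> -> ->]]|[k]].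
    by exists k; rewrite // !inE /=.
  by rewrite !inE => /= /eqP <- ->; exists (v, k); rewrite ?finset.in_setT.
have DK e : #|D e| <= K.
  apply: (leq_trans (leq_imset_card _ _)).
  by apply: (leq_trans (max_card _)); rewrite card_ord.
have := prescribed_le g DK; rewrite card_ord; apply: leq_trans.
rewrite leq_mul2r; apply/orP; right.
apply: subset_leq_card; apply/fintype.subsetP => a.
rewrite !finset.inE => /forallP aF; apply/forallP => -[u v].
apply/'forall_implyP => i /imsetP[k]; rewrite !inE /= => /eqP ku ->.
rewrite /g /=; case: pickP => [j|/(_ k)]; last by rewrite ku !eqxx.
case/andP => /eqP ju /eqP jk; rewrite -jk -(eqP (aF j)) ffunE -ju.
by rewrite permKV.
Qed.

(** The landings are dominated by independent collision-free functions: forgetting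
that they are injective only enlarges the count, at the price of the factor
(l / (l - K))^n for each probe. *)
Lemma sparse_branch_prob (c : R) : (0 <= c)%R -> (2 * l%:R * c <= #|T2|%:R)%R ->
  (#|[set G in lifts Kn l | sparse_branch G]%SET|%:R <=
   (expR ((n + 2 * m)%:R / (2 * l%:R) -
           c / (1 + 2 * c) * (#|X|%:R * #|T1|%:R - (n + 2 * m)%:R) / l%:R) *
    (l%:R / (l - K)%:R) ^+ n) ^+ K * #|lifts Kn l|%:R)%R.
Proof.
move=> c0 cT; set q := expR _.
apply: (twist_average (th := probe_twist)).
  by rewrite card_ffun_perm prodn_gt0 // => e; exact: fact_gt0.
move=> G GL; set S := finset _.
have lK0 : (0 < (l - K)%:R :> R)%R by rewrite ltr0n subn_gt0.
have [->|[a0]] := set_0Vmem S.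
  by rewrite finset.cards0 mulr_ge0 // exprn_ge0 // mulr_ge0 ?expR_ge0 // exprn_ge0 // divr_ge0.
rewrite finset.inE => /andP[bl0 em0].
pose CF := [set f | collision_free (slot_nbrs G) T1 T2 f]%SET.
pose J := [set F : {ffun 'I_K -> {ffun 'I_n -> 'I_l}} | [forall k, F k \in CF]]%SET.
have cJ : (#|J|%:R <= (l%:R ^+ n * q) ^+ K :> R)%R.
  rewrite card_ffun_all prod_nat_const card_ord natrX; apply: lerXn2r; rewrite ?nnegrE ?ler0n //.
    by rewrite mulr_ge0 ?expR_ge0 // exprn_ge0.
  have := card_collision_free (R := R) (leq_ltn_trans (leq0n K) Kl)
    (fun v i => card_slot_nbrs v i GL bl0) _ T12 c0 cT.
  move/(_ X); rewrite card_ffun !card_ord natrX; apply.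
    move=> v i; rewrite /slot_nbrs; case: ifP => _; first exact: finset.sub0set.
    by apply/fintype.subsetP => x; rewrite finset.inE => /andP[].
  rewrite ler_nat; exact: (sum_missed GL em0).
have -> : S = [set a in [set: A] | sparse_branch (twist (probe_twist a) G)]%SET.
  by apply/finset.setP => a; rewrite !finset.inE.
apply: (le_trans (union_bound (J := J)
  (Q := fun a => sparse_branch (twist (probe_twist a) G))
  (F := fun F a => [forall k, landing G a k == F k])
  (c := #|A|%:R / (l - K)%:R ^+ (n * K)) _ _)).
- move=> a _ /andP[bl _]; exists [ffun k => landing G a k].
    rewrite finset.inE; apply/forallP => k; rewrite ffunE finset.inE.
    exact: landing_collision_free.
  by apply/forallP => k; rewrite ffunE.
- move=> F _; rewrite ler_pdivlMr ?exprn_gt0 // -natrX -natrM ler_nat.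
  apply: leq_trans (card_landing F GL); rewrite leq_mul2r; apply/orP; right.
  by apply: subset_leq_card; apply/fintype.subsetP => a; rewrite !finset.inE.
rewrite mulrCA [leRHS]mulrC ler_wpM2l //.
rewrite ler_pdivrMr ?exprn_gt0 // exprM -exprMn -mulrA -exprMn.
by rewrite divfK ?expf_neq0 ?lt0r_neq0 // mulrC.
Qed.

End Spread.

(** * Elementary estimates *)

Lemma bin_le_expn N k : 'C(N, k) <= N ^ k.
Proof.
apply: (@leq_trans (N ^_ k)); first by rewrite -bin_ffact leq_pmulr ?fact_gt0.
by elim: k => // k IH; rewrite ffactnSr expnSr leq_mul ?leq_subr.
Qed.

Lemma bin_le_pow2 N k : 'C(N, k) <= 2 ^ N.
Proof.
rewrite -[N in 'C(N, _)]card_ord -card_draws.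
apply: (leq_trans (max_card _)).
by rewrite -cardsT -powersetT card_powerset cardsT card_ord.
Qed.

(** An inclusion-minimal [U] of weight at least n / E has weight less than
n / E + l, which leaves at least n - l - n / E >= n / E for the complement. *)
Lemma split_weights (I : finType) (b : I -> nat) (n l E : nat) :
  \sum_u b u = n -> (forall u, b u <= l) -> l <= n -> 2 * n <= E * (n - l) ->
  exists U : {set I},
    n <= E * \sum_(u in U) b u /\ n <= E * \sum_(u in ~: U) b u.
Proof.
move=> bn bl ln En.
have [n0|n0] := posnP n; first by exists finset.set0; rewrite n0.
have E0 : 0 < E by case: E En => //; lia.
pose P (U : {set I}) := n <= E * \sum_(u in U) b u.
have PT : P [set: I]%SET.
  by rewrite /P; under eq_bigl do rewrite finset.in_setT; rewrite bn leq_pmull.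
case: (arg_minnP (fun U : {set I} => #|U|) PT) => U PU Umin.
exists U; split => //.
have [U0|[u uU]] := set_0Vmem U.
  by move: PU; rewrite /P U0 big_set0 muln0 leqNgt n0.
have : ~~ P (U :\ u)%SET.
  by apply/negP => /Umin; rewrite [X in X <= _](cardsD1 u) uU ltnn.
rewrite /P -ltnNge => lt.
have e1 : \sum_(v in U) b v = b u + \sum_(v in (U :\ u)%SET) b v.
  exact: (big_setD1 u uU).
have e2 : \sum_(v in U) b v + \sum_(v in ~: U) b v = n.
  by rewrite -[RHS]bn [RHS](bigID (mem U)) /=; congr (_ + _); apply: eq_bigl => v; rewrite finset.inE.
have := bl u; move: e1 e2 lt En.
move: (\sum_(v in U) _) (\sum_(v in ~: U) _) (\sum_(v in (U :\ u)%SET) _).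
move=> x y z -> <- lt En bu; nia.
Qed.

Section Numerics.
Variable R : realType.
Local Open Scope ring_scope.

Lemma expR_half_le2 : expR (1 / 2) <= 2 :> R.
Proof.
have := expR_ge1Dx (- (1 / 2) : R); rewrite expRN => h.
rewrite -[leRHS]invrK -lef_pV2 ?posrE ?expR_gt0 ?invr_gt0 // invrK.
by apply: le_trans h; lra.
Qed.

Lemma le2_expR1 : 2 <= expR 1 :> R.
Proof. by have := expR_ge1Dx (1 : R); rewrite -natr1. Qed.

Lemma expR_le_pow2 (p : nat) : expR (p%:R / 2) <= 2 ^+ p :> R.
Proof.
rewrite -div1r expRM_natl; apply: lerXn2r; rewrite ?nnegrE ?expR_ge0 //.
exact: expR_half_le2.
Qed.

Lemma pow2_le_expR (p : nat) : 2 ^+ p <= expR p%:R :> R.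
Proof.
rewrite -[p%:R]mulr1 expRM_natl; apply: lerXn2r; rewrite ?nnegrE ?expR_ge0 //.
exact: le2_expR1.
Qed.

Lemma poly_expR_le (C W n : nat) : (0 < W)%N -> (0 < n)%N ->
  (2 * (W ^ C.+1 * C.+1`!) <= n)%N ->
  n%:R ^+ C * expR (- (n%:R / W%:R)) <= 1 / 2 :> R.
Proof.
move=> W0 n0 h.
have W0' : 0 < W%:R :> R by rewrite ltr0n.
have n0' : 0 < n%:R :> R by rewrite ltr0n.
rewrite expRN ler_pdivrMr ?expR_gt0 //.
have := @expR_ge1Dxn R (n%:R / W%:R) C; rewrite divr_ge0 // => /(_ isT) e.
suff s : n%:R ^+ C <= 1 / 2 * ((n%:R / W%:R) ^+ C.+1 / C.+1`!%:R) :> R.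
  by apply: (le_trans s); rewrite ler_wpM2l // ?divr_ge0 //; apply: le_trans e; rewrite lerDr.
have f0 : 0 < C.+1`!%:R :> R by rewrite ltr0n fact_gt0.
have w0 : 0 < W%:R ^+ C.+1 :> R by rewrite exprn_gt0.
have -> : 1 / 2 * ((n%:R / W%:R) ^+ C.+1 / C.+1`!%:R) =
    n%:R ^+ C * (n%:R / (2 * (W%:R ^+ C.+1 * C.+1`!%:R))) :> R.
  rewrite expr_div_n [n%:R ^+ C.+1]exprSr; field.
  by rewrite !lt0r_neq0.
rewrite ler_peMr ?exprn_ge0 // ler_pdivlMr ?mulr_gt0 // mul1r.
by rewrite -natrX -!natrM ler_nat.
Qed.

(** The value a = 1/6 turns the factor a / (1 + 2 a) into 1/8.  The main term is
then at least N^2 / (24 E L), and the error terms cost at most half of it. *)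
Lemma collision_exponent (N L D x t Er : R) : (0 < L -> L <= N -> 0 < Er ->
  D * (30 * Er) <= N * N -> N <= Er * x -> N <= 3 * t ->
  D / (2 * L) - (1 / 6) / (1 + 2 * (1 / 6)) * (x * t - D) / L
    <= - (N / (48 * Er)))%R.
Proof.
move=> L0 LN E0 DN xN tN; have N0 : (0 < N)%R by exact: lt_le_trans LN.
have -> : (D / (2 * L) - 1 / 6 / (1 + 2 * (1 / 6)) * (x * t - D) / L =
  - ((x * t - 5 * D) / 8 / L))%R by field; lra.
rewrite lerN2 ler_pdivlMr // mulrAC ler_pdivrMr ?mulr_gt0 //.
have xt : (N * N <= 3 * (Er * (x * t)))%R.
  have -> : (3 * (Er * (x * t)) = (Er * x) * (3 * t))%R by ring.
  by apply: ler_pM => //; exact: ltW.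
have NL : (N * L <= N * N)%R by rewrite ler_wpM2l // ltW.
have -> : ((x * t - 5 * D) / 8 * (48 * Er) = 2 * (3 * (Er * (x * t))) - D * (30 * Er))%R.
  by field.
lra.
Qed.

(** The constant 768 makes the injectivity loss [8 * k] at most half of the gain
[N / (48 * Er)] of one probe; doubling it in the lower bound on [k] leaves room
for rounding the number of probes down. *)
Lemma probe_exponent (N k Er : R) : (0 < Er -> k * (768 * Er) <= N ->
  N <= k * (1536 * Er) ->
  k * (- (N / (48 * Er)) + 8 * k) <= - (N * N / (384 * Er) ^+ 2))%R.
Proof.
move=> E0 h1 h2.
have k0 : (0 <= k)%R by nra.
have N0 : (0 <= N)%R by nra.
have h : (8 * k <= N / (96 * Er))%R by rewrite ler_pdivlMr ?mulr_gt0 //; lra.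
apply: (@le_trans _ _ (k * - (N / (96 * Er))))%R.
  rewrite ler_wpM2l //.
  have -> : (N / (48 * Er) = 2 * (N / (96 * Er)))%R by field; rewrite lt0r_neq0.
  by lra.
rewrite mulrN lerN2 ler_pdivrMr ?exprn_gt0 ?mulr_gt0 //.
have -> : (k * (N / (96 * Er)) * (384 * Er) ^+ 2 = N * (k * (1536 * Er)))%R.
  by field; rewrite lt0r_neq0.
by rewrite ler_wpM2l.
Qed.

Lemma ratio_expn_le (n l K : nat) : (K < l)%N -> (n <= 8 * (l - K))%N ->
  ((l%:R / (l - K)%N%:R) ^+ n <= expR (8 * K%:R) :> R)%R.
Proof.
move=> Kl nl.
have M0 : (0 < (l - K)%N%:R :> R)%R by rewrite ltr0n subn_gt0.
have -> : (l%:R / (l - K)%N%:R = 1 + K%:R / (l - K)%N%:R :> R)%R.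
  by rewrite -{1}(subnK (ltnW Kl)) natrD mulrDl mulfV ?lt0r_neq0.
apply: (@le_trans _ _ (expR (K%:R / (l - K)%N%:R) ^+ n))%R.
  by apply: lerXn2r; rewrite ?nnegrE ?expR_ge0 ?expR_ge1Dx // addr_ge0 ?divr_ge0.
rewrite -expRM_natl ler_expR mulrA ler_pdivrMr // -mulrA [leRHS]mulrCA mulrC.
by rewrite ler_wpM2l // -natrM ler_nat.
Qed.

End Numerics.

(** * A fixed set of branch vertices *)

Section FixedBranchSet.

Variables (R : realType) (n l : nat).
Local Notation vert := ('I_n * 'I_l)%type.
Local Notation Kn := (complete_graph 'I_n).
Variable B : {set vert}.
Hypothesis Bn : #|B| = n.

(** There are at most exp(n^2) sets of inner pairs, and l^(m/2) exceeds exp(2 n^2)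
for [m] of order n^2 / (120 E), by the choice of the exponent [960 * E]. *)
Lemma dense_prob_large E : 0 < E -> 2 ^ (960 * E) <= l ->
  (#|[set G in lifts Kn l | (n * n %/ (120 * E) < #|inner_edges G B|)%N]%SET|%:R
   <= expR (- (n%:R * n%:R)) * #|lifts Kn l|%:R :> R)%R.
Proof.
move=> E0 lE; set m := n * n %/ _.
have q1 : (1 <= expR (- (2 * (n%:R * n%:R))) ^+ 2 * l%:R ^+ m.+1 :> R)%R.
  rewrite -expRM_natr mulNr expRN ler_pdivlMl ?expR_gt0 // mulr1.
  apply: (@le_trans _ _ (2 ^+ (960 * E * m.+1)))%R.
    apply: le_trans (expR_le_pow2 R _); rewrite ler_expR.
    have : n * n <= m.+1 * (120 * E) by rewrite ltnW // ltn_ceil // muln_gt0 E0.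
    rewrite -(ler_nat R) !natrM; set a := (n%:R * n%:R)%R; lra.
  rewrite exprM; apply: lerXn2r; rewrite ?nnegrE ?ler0n ?exprn_ge0 //.
  by rewrite -natrX ler_nat.
apply: (le_trans (inner_edges_prob B (expR_ge0 _) q1)).
rewrite ler_wpM2r //.
apply: (@le_trans _ _ (expR (n%:R * n%:R) * expR (- (2 * (n%:R * n%:R)))))%R.
  rewrite ler_wpM2r ?expR_ge0 //.
  rewrite -natrM; apply: le_trans (pow2_le_expR R _).
  rewrite -natrX ler_nat; apply: (leq_trans (bin_le_pow2 _ _)).
  rewrite leq_exp2l //; have := card_inner_pairs B; rewrite Bn; nia.
rewrite -expRD ler_expR; set a := (n%:R * n%:R)%R; lra.
Qed.

(** Here all but n L of the pairs in [B] are edges.  There are only n^(O(n L))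
such sets of edges, and each has probability at most 2^(-m/2). *)
Lemma dense_prob_small L : 1 < l -> l <= L -> 4 * L + 2 <= n ->
  (#|[set G in lifts Kn l | branch_like G B]%SET|%:R
   <= n%:R ^+ (2 * (n * L)) * expR (- (n%:R * n%:R / 16)) * #|lifts Kn l|%:R :> R)%R.
Proof.
move=> l1 lL Ln; set N := 'C(n, 2); set m := N - n * L.
have N2 : 2 * N = n * n.-1 by rewrite mulnC -[2]/(2`!) bin_ffact ffactnS ffactn1.
have nLN : n * L <= N by nia.
have nlL : n * l <= n * L by rewrite leq_mul2l lL orbT.
have sub : [set G in lifts Kn l | branch_like G B]%SET \subset
    [set G in lifts Kn l | (m <= #|inner_edges G B|)%N]%SET.
  apply/fintype.subsetP => G /setIdP[GL bl]; rewrite finset.inE GL /=.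
  have := inner_edges_lower GL Bn bl; rewrite /m -N2 leq_subLR => h.
  rewrite -(@leq_pmul2l 2) // (leq_trans h) // mulnDr addnC leq_add2r leq_mul2l /=.
  by rewrite (leq_trans (leq_subr _ _)).
have q1 : (1 <= expR (- (m%:R / 4)) ^+ 2 * l%:R ^+ m :> R)%R.
  rewrite -expRM_natr mulNr expRN ler_pdivlMl ?expR_gt0 // mulr1.
  apply: (@le_trans _ _ (2 ^+ m))%R.
    by apply: le_trans (expR_le_pow2 R _); rewrite ler_expR; lra.
  by apply: lerXn2r; rewrite ?nnegrE ?ler0n // ler_nat.
apply: (le_trans _ (le_trans (inner_edges_prob B (expR_ge0 _) q1) _)).
  by rewrite ler_nat subset_leq_card.
rewrite ler_wpM2r //; apply: ler_pM; rewrite ?expR_ge0 //; last first.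
  rewrite ler_expR lerN2.
  have : n * n <= 4 * m.
    rewrite /m; move: N2 nLN Ln; case: (n) => [|k] //=; nia.
  rewrite -(ler_nat R) !natrM; set a := (n%:R * n%:R)%R; lra.
rewrite -natrX ler_nat.
apply: (@leq_trans 'C(N, m)).
  by apply: leq_bin2l; have := card_inner_pairs B; rewrite Bn; lia.
rewrite -bin_sub ?leq_subr // /m subKn //; apply: (leq_trans (bin_le_expn _ _)).
rewrite [leqRHS]expnM; have [->|nL0] := posnP (n * L); first by rewrite !expn0.
rewrite leq_exp2r //; nia.
Qed.

End FixedBranchSet.

Section Sparse.

Variables (R : realType) (n l E : nat).
Local Notation vert := ('I_n * 'I_l)%type.
Local Notation Kn := (complete_graph 'I_n).
Variable B : {set vert}.
Hypothesis Bn : #|B| = n.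

(** No fiber contains more than [l] vertices of [B], and n - l >= 2 n / E. *)
Lemma branch_split : l <= n -> 2 * n <= E * (n - l) ->
  exists U : {set 'I_n}, n <= E * #|[set x in B | x.1 \in U]%SET| /\
                         n <= E * #|[set x in B | x.1 \notin U]%SET|.
Proof.
move=> ln En; pose b u := #|[set x in B | x.1 == u]%SET|.
have bE (U : {set 'I_n}) : \sum_(u in U) b u = #|[set x in B | x.1 \in U]%SET|.
  rewrite -sum1_card (partition_big (fun x : vert => x.1) (mem U)) /=; last first.
    by move=> x; rewrite finset.inE => /andP[].
  apply: eq_bigr => u uU; rewrite /b -sum1_card; apply: eq_bigl => x.
  rewrite !finset.in_set; case: eqVneq => [->|]; rewrite ?andbF //.
  by rewrite uU !andbT.
have bl u : b u <= l.
  rewrite -[leqRHS](card_ord l) /b.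
  rewrite -(@card_in_imset _ _ snd); first exact: max_card.
  move=> [v i] [w j]; rewrite !finset.inE /= => /andP[_ /eqP ->].
  by case/andP => _ /eqP -> ->.
have bn : \sum_u b u = n.
  transitivity (\sum_(u in [set: 'I_n]%SET) b u).
    by apply: eq_bigl => u; rewrite finset.in_setT.
  by rewrite bE -[RHS]Bn; apply: eq_card => x; rewrite !finset.inE andbT.
have [U [U1 U2]] := split_weights bn bl ln En.
exists U; rewrite -bE; split => //; move: U2; rewrite bE.
by congr (_ <= _ * _); apply: eq_card => x; rewrite !finset.inE.
Qed.

(** If l < n / 4, the edges leaving [B] are too few for the degrees to fit.
Otherwise the split of [B] supplies [X] and the probes, K = n / (768 E) of them,
and the fibers without probes are divided into two sets of at least n / 3 each. *)
Lemma sparse_prob : 0 < E -> 768 * E <= n -> 0 < l <= n -> 2 * n <= E * (n - l) ->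
  (#|[set G in lifts Kn l | branch_like G B &&
        (#|inner_edges G B| <= n * n %/ (120 * E))%N]%SET|%:R
   <= expR (- (n%:R * n%:R / (384 * E)%:R ^+ 2)) * #|lifts Kn l|%:R :> R)%R.
Proof.
move=> E0 nE /andP[l0 ln] En; set m := n * n %/ _.
have mE : m * (120 * E) <= n * n by exact: leq_trunc_div.
have nE60 : 60 * E * n <= n * n by rewrite leq_mul2r; apply/orP; right; lia.
have DE : (n + 2 * m) * (30 * E) <= n * n by nia.
have n768 : 768 <= n by clear -nE E0; nia.
have [n4l|l4n] := leqP n (4 * l); last first.
  rewrite (_ : [set G in _ | _]%SET = finset.set0).
    by rewrite finset.cards0 mulr_ge0 ?expR_ge0.
  apply/finset.setP => G; rewrite !finset.in_set0 finset.in_set; apply/negP.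
  case/and3P => GL bl em; have := inner_edges_lower GL Bn bl.
  have : 60 * m <= n * n by nia.
  have : 4 * (n * l) <= n * n by rewrite mulnCA leq_mul2l (ltnW l4n) orbT.
  have : n * n.-1 + n = n * n by rewrite -mulnSr prednK //; lia.
  have : 2 * n <= n * n by rewrite leq_mul2r; apply/orP; right; lia.
  have : 0 < n by lia.
  move: em; rewrite -/m; clear -m; move: (n * n) (n * l) (n * n.-1) m => nn nl nn' m.
  by move: #|inner_edges G B| => e; lia.
have [U [XU YU]] := branch_split ln En.
pose K := n %/ (768 * E).
have KE : K * (768 * E) <= n by exact: leq_trunc_div.
have K768 : K * 768 <= n by nia.
have KE' : n <= K * (1536 * E).
  have K0 : 0 < K by rewrite divn_gt0 // muln_gt0 E0.
  have : n < K.+1 * (768 * E) by rewrite ltn_ceil // muln_gt0 E0.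
  by nia.
set X := finset _ in XU; set Y := finset _ in YU.
have KY : K <= #|Y| by nia.
pose probe (k : 'I_K) : vert := enum_val (widen_ord KY k).
have probe_Y k : probe k \in Y by exact: enum_valP.
have probe_inj : injective probe by move=> j k /enum_val_inj/(congr1 val) jk; apply: val_inj.
have Pc : #|probe_fibers probe| <= K.
  by apply: (leq_trans (leq_imset_card _ _)); rewrite card_ord.
have PC : n - K <= #|~: probe_fibers probe|.
  by have := cardsC (probe_fibers probe); rewrite card_ord; lia.
have [T1 T1P T1c] : exists2 T1 : {set 'I_n}, T1 \subset ~: probe_fibers probe & #|T1| = n %/ 3 + 1.
  by apply: subset_of_card; clear -PC K768 n768; lia.
pose T2 := (~: probe_fibers probe) :\: T1.
have T2c : n <= 3 * #|T2|.
  have := cardsD (~: probe_fibers probe) T1; rewrite (finset.setIidPr T1P) T1c -/T2 => ->.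
  by clear -PC K768 n768; lia.
have Kl : K < l by clear -K768 n4l l0; lia.
have T1n : n <= 3 * #|T1| by rewrite T1c; clear; lia.
have T12 : [disjoint T1 & T2] by rewrite -setI_eq0 /T2 finset.setIDA finset.setDIl finset.setDv finset.set0I.
have T12_probe_fibers v : v \in T1 :|: T2 -> v \notin probe_fibers probe.
  rewrite finset.inE => /orP[/(fintype.subsetP T1P)|/finset.setDP[]]; by rewrite finset.inE.
have X_probe_fibers x : x \in X -> x.1 \notin probe_fibers probe.
  rewrite finset.inE => /andP[_ xU]; apply/imsetP => -[k _ xk].
  by have := probe_Y k; rewrite finset.inE -xk xU andbF.
have XB : X \subset B by apply/fintype.subsetP => x; rewrite finset.inE => /andP[].
have probe_B k : probe k \in B by have := probe_Y k; rewrite finset.inE => /andP[].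
have lR : (0 < l%:R :> R)%R by rewrite ltr0n.
have cT2 : (2 * l%:R * (1 / 6) <= #|T2|%:R :> R)%R.
  have : l <= 3 * #|T2| by exact: leq_trans T2c.
  by rewrite -(ler_nat R) natrM; clear; lra.
have := @sparse_branch_prob R n l K m B X probe T1 T2 Kl _ XB probe_B probe_inj X_probe_fibers T12_probe_fibers T12 (1 / 6)%R _ cT2.
rewrite Bn => /(_ (leqnn n) (divr_ge0 ler01 (ler0n _ _))) h.
apply: (le_trans h); rewrite ler_wpM2r // => {h}.
apply: (@le_trans _ _ (expR (- (n%:R / (48 * E%:R)) + 8 * K%:R) ^+ K))%R.
  apply: lerXn2r; rewrite ?nnegrE ?expR_ge0 //.
    by rewrite mulr_ge0 ?expR_ge0 // exprn_ge0 // divr_ge0.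
  rewrite [leRHS]expRD; apply: ler_pM; rewrite ?expR_ge0 ?exprn_ge0 ?divr_ge0 //.
    rewrite ler_expR; apply: collision_exponent => //.
    - by rewrite ler_nat.
    - by rewrite ltr0n.
    - by rewrite -!natrM ler_nat.
    - by rewrite -natrM ler_nat.
    - by rewrite -natrM ler_nat.
  by apply: ratio_expn_le => //; clear -n4l K768; lia.
rewrite -expRM_natl ler_expR natrM; apply: probe_exponent; first by rewrite ltr0n.
  by rewrite -!natrM ler_nat.
by rewrite -!natrM ler_nat.
Qed.

End Sparse.

(** * The union bound and the limit *)

Lemma branch_like_prob (R : realType) (n l E L : nat) (B : {set 'I_n * 'I_l}) :
  #|B| = n -> 0 < E -> 768 * E <= n -> 2 ^ (960 * E) <= L -> 4 * L + 2 <= n ->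
  1 < l <= n -> 2 * n <= E * (n - l) ->
  (#|[set G in lifts (complete_graph 'I_n) l | branch_like G B]%SET|%:R <=
   n%:R ^+ (2 * (n * L)) * (2 * expR (- (n%:R * n%:R / (384 * E)%:R ^+ 2)))
     * #|lifts (complete_graph 'I_n) l|%:R :> R)%R.
Proof.
move=> Bn E0 nE EL Ln /andP[l1 ln] En.
have n0 : 0 < n by lia.
have E1 : (1 <= E%:R :> R)%R by rewrite ler1n.
have W16 : (16 <= (384 * E)%:R ^+ 2 :> R)%R by rewrite natrM expr2; nra.
have NN0 : (0 <= n%:R * n%:R :> R)%R by rewrite -natrM.
set e := expR _; have e0 : (0 <= e)%R by exact: expR_ge0.
have expW (c : R) : (0 < c)%R -> (c <= 16)%R -> (expR (- (n%:R * n%:R / c)) <= e)%R.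
  move=> c0 c16; rewrite ler_expR lerN2 ler_wpM2l // lef_pV2 ?posrE //.
    exact: le_trans W16.
  exact: lt_le_trans W16.
have [lL|Ll] := leqP l L.
  apply: (le_trans (dense_prob_small R Bn l1 lL Ln)).
  rewrite ler_wpM2r // ler_wpM2l ?exprn_ge0 //.
  by apply: (le_trans (expW 16%R _ _)) => //; lra.
have E2 : 2 ^ (960 * E) <= l by exact: leq_trans EL (ltnW Ll).
set m := n * n %/ (120 * E).
pose S1 := [set G in lifts (complete_graph 'I_n) l | (m < #|inner_edges G B|)%N]%SET.
pose S2 := [set G in lifts (complete_graph 'I_n) l | branch_like G B &&
        (#|inner_edges G B| <= m)%N]%SET.
apply: (@le_trans _ _ (#|S1|%:R + #|S2|%:R)%R).
  rewrite -natrD ler_nat; apply: leq_trans (leq_card_setU _ _).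
  apply: subset_leq_card; apply/fintype.subsetP => G; rewrite !finset.in_setU.
  by rewrite !(finset.in_set (fun _ => _)) => /andP[-> ->] /=; case: leqP.
have l0n : 0 < l <= n by rewrite ln andbT ltnW.
apply: (le_trans (lerD (dense_prob_large R Bn E0 E2) (sparse_prob R Bn E0 nE l0n En))).
rewrite -mulrDl ler_wpM2r // -/e.
have := expW 1%R ltr01 _; rewrite invr1 mulr1 => h.
apply: (@le_trans _ _ (2 * e)%R); first by have := h _; lra.
by rewrite ler_peMl ?mulr_ge0 // -natrX ler1n expn_gt0 n0.
Qed.

(** The n-sets of vertices number at most (n l)^n <= n^(2n). *)
Lemma clique_prob_le (R : realType) (n l E L : nat) :
  0 < E -> 768 * E <= n -> 2 ^ (960 * E) <= L -> 4 * L + 2 <= n ->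
  1 < l <= n -> 2 * n <= E * (n - l) ->
  (lift_probability R (complete_graph 'I_n) l (has_topological_clique n) <=
   2 * (n%:R ^+ (2 * L + 2) * expR (- (n%:R / ((384 * E) ^ 2)%:R))) ^+ n)%R.
Proof.
move=> E0 nE EL Ln lP En; rewrite /lift_probability.
set q := (2 * _)%R; have q0 : (0 <= q)%R.
  by rewrite mulr_ge0 // exprn_ge0 // mulr_ge0 ?expR_ge0 ?exprn_ge0.
have [->|c0] := posnP #|lifts (complete_graph 'I_n) l|; first by rewrite invr0 mulr0.
rewrite ler_pdivrMr ?ltr0n //.
pose J := [set B : {set 'I_n * 'I_l} | #|B| == n]%SET.
set S := #|lifts _ _|%:R%R.
pose c := (n%:R ^+ (2 * (n * L)) * (2 * expR (- (n%:R * n%:R / (384 * E)%:R ^+ 2))) * S)%R : R.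
apply: (@le_trans _ _ (#|J|%:R * c)%R).
  apply: (union_bound (Q := fun G => `[< has_topological_clique n G >])
    (F := fun (B : {set 'I_n * 'I_l}) G => branch_like G B)).
    move=> G GL /asboolP /(clique_branch_like (esym (card_ord n)) GL)[B Bn bl].
    by exists B; rewrite // finset.inE Bn.
  by move=> B; rewrite finset.inE => /eqP Bn; exact: branch_like_prob.
rewrite /c mulrA ler_wpM2r //.
have cJ : (#|J|%:R <= n%:R ^+ (2 * n) :> R)%R.
  rewrite -natrX ler_nat card_draws card_prod !card_ord.
  apply: (leq_trans (bin_le_expn _ _)); rewrite expnM.
  have [->|n0] := posnP n; first by rewrite !expn0.
  by rewrite leq_exp2r // -mulnn leq_mul2l; case/andP: lP => _ ->; rewrite orbT.
rewrite mulrA mulrCA; apply: (@le_trans _ _ (2 * (n%:R ^+ (2 * n) * (n%:R ^+ (2 * (n * L)) * expR (- (n%:R * n%:R / (384 * E)%:R ^+ 2)))))%R).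
  by rewrite ler_wpM2l // -[leLHS]mulrA ler_wpM2r // mulr_ge0 ?exprn_ge0 ?expR_ge0.
rewrite /q exprMn -expRM_natl -exprM (mulrA (n%:R ^+ (2 * n)))%R -exprD mulrN natrX.
by rewrite (mulrA n%:R)%R (_ : 2 * n + _ = (2 * L + 2) * n) //; lia.
Qed.

Local Open Scope classical_set_scope.
Local Open Scope ring_scope.

Theorem theorem1p3 (R : realType) (eps : R) (l : nat -> nat)
    (eps_gt0 : 0 < eps)
    (l_gt0 : forall n : nat, (0 < l n)%N)
    (l_gt1 : \forall n \near \oo, (1 < l n)%N)
    (l_le : \forall n \near \oo, (l n)%:R <= (1 - eps) * n%:R) :
  (fun n : nat =>
     lift_probability R (complete_graph 'I_n) (l n)
       (has_topological_clique n)) @ \oo --> (0 : R).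
Proof.
(* The bounds below are used through E and L only by the inequalities they
   satisfy; named witnesses keep the huge numerals from being evaluated. *)
have [E E0 Eeps] : exists2 E : nat, (0 < E)%N & 2 <= E%:R * eps.
  exists (Num.truncn (2 / eps)).+1 => //.
  by rewrite -ler_pdivrMr // ltW // truncnS_gt.
have [L EL] : exists L, (2 ^ (960 * E) <= L)%N by exists (2 ^ (960 * E))%N.
have [C CE] : exists C, C = (2 * L + 2)%N by exists (2 * L + 2)%N.
have [W WE] : exists W, W = ((384 * E) ^ 2)%N by exists ((384 * E) ^ 2)%N.
have W0 : (0 < W)%N by rewrite WE expn_gt0 muln_gt0 E0.
have [M ME] : exists M, (2 * (W ^ C.+1 * C.+1`!) <= M)%N.
  by exists (2 * (W ^ C.+1 * C.+1`!))%N.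
have g0 : geometric 2 (1 / 2 : R) @ \oo --> (0 : R).
  by apply: cvg_geometric; rewrite ger0_norm; lra.
apply: (squeeze_cvgr _ (cvg_cst (0 : R)) g0).
near=> n.
have l1 : (1 < l n)%N by near: n.
have le : (l n)%:R <= (1 - eps) * n%:R :> R by near: n.
have nE : (768 * E <= n)%N by near: n; exact: nbhs_infty_ge.
have nL : (4 * L + 2 <= n)%N by near: n; exact: nbhs_infty_ge.
have nM : (M <= n)%N by near: n; exact: nbhs_infty_ge.
have n0 : (0 < n)%N by apply: leq_trans nL; rewrite addn2.
have ln : (l n <= n)%N.
  rewrite -(ler_nat R); apply: (le_trans le).
  by rewrite mulrBl mul1r gerBl mulr_ge0 // ltW.
have En : (2 * n <= E * (n - l n))%N.
  rewrite -(ler_nat R) !natrM natrB //.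
  apply: (@le_trans _ _ (E%:R * (eps * n%:R))); first by rewrite mulrA ler_wpM2r.
  by rewrite ler_wpM2l // lerBrDr -lerBrDl; move: le; rewrite mulrBl mul1r.
apply/andP; split; first by rewrite divr_ge0.
have l1n : (1 < l n <= n)%N by rewrite l1.
apply: (le_trans (clique_prob_le R E0 nE EL nL l1n En)).
rewrite -CE -WE ler_wpM2l //; apply: lerXn2r; rewrite ?nnegrE ?divr_ge0 //.
  by rewrite mulr_ge0 ?expR_ge0 // exprn_ge0.
by apply: poly_expR_le => //; exact: leq_trans nM.
Unshelve. all: by end_near.
Qed.
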